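(* In the setting of the context, there is a constant $j_*$ depending only on the geometric data (including the chosen $x_{\{i,k\}}$) such that for every supersymmetric configuration with $j_I\ge j_*$ for all $I=0,\dots,p$, $$0\le-\sum_\gamma N^\gamma C(m^\gamma,m^\gamma)\le T_0+\tfrac12\max(x_{\{i,k\}})\cdot\min(T_i)\cdot\max(T_i),$$ where the sum is over all $\gamma$-branes, the maximum of $x_{\{i,k\}}$ is over all pairs of distinct indices in $\{1,\dots,p\}$, and the minimum and maximum of $T_i$ are over $i\in\{1,\dots,p\}$. Consequently, only finitely many flux vectors $m^\gamma$ occur on $\gamma$-branes.
   Context: Geometry. $B$ is a smooth projective complex surface, $\pi:X\to B$ is a smooth elliptically fibered Calabi--Yau threefold with a single section $\sigma$, so $\sigma^2=-c_1\sigma$ and $H^{1,1}(X)$ is spanned by $\sigma$ and $\pi^*H^{1,1}(B)$; $c_1,c_2$ are the Chern classes of $B$. Let $D_1,\dots,D_p\in H^2(B,\mathbb{Z})$, $p=h^{1,1}(B)\ge2$, be linearly independent classes generating the Kähler cone of $B$ or a simplicial subcone; their pullbacks to $X$ are denoted by the same symbols, and $D_0=\sigma+\pi^*c_1$. Let $C$ be the intersection form on $H^{1,1}(B)$, $C_{ij}=D_i\cdot D_j$. Write $c_1=\sum_i b_iD_i$, $b=(b_i)$, $\mathcal K_{00i}=\sum_j b_jC_{ij}$, $\mathcal K_{000}=\sum_{i,j} b_ib_jC_{ij}$. The triple intersection form $\mathcal K$ on $X$ is the symmetric trilinear form with $\mathcal K(D_i,D_j,D_k)=0$, $\mathcal K(D_0,D_i,D_j)=C_{ij}$,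 $\mathcal K(D_0,D_0,D_i)=\mathcal K_{00i}$, $\mathcal K(D_0,D_0,D_0)=\mathcal K_{000}$. Put $T_0=\int_B(c_2+11c_1^2)$ and $T_i=12\,\mathcal K_{00i}$. Assume: (1) all $D_i$ are time-like or light-like for $C$ ($C(D_i,D_i)\ge0$) and lie in the same closed light-cone; (2) $b_i\ge 0$ for all $i$; (3) every $\mathcal K_{00i}$ is a positive integer; (4) $C$ has signature $(1,p-1)$. For each pair $\{i,k\}$, $i\ne k$, fix a positive rational number $x_{\{i,k\}}$ such that the matrix $(M_{\{i,k\}})_{jl}=x_{\{i,k\}}C_{ij}C_{kl}+x_{\{i,k\}}C_{il}C_{kj}-C_{jl}$ is positive semi-definite (such numbers exist under (1), (4)). Supersymmetric configuration: a finite collection of D9-brane stacks $\alpha$, each with a positive integer $N^\alpha$ and a flux $F^\alpha=m_0^\alpha D_0+\sum_{i}m_i^\alpha D_i\in H^2(X,\mathbb{Z})$ ($m_I^\alpha\in\mathbb{Q}$, $m_0^\alpha\in\mathbb{Z}$, $\sum_jC_{ij}m_j^\alpha\in\mathbb{Z}$), non-negative integers $n^{D5}_0,\dots,n^{D5}_p$, and a real Kähler class $J=j_0D_0+\sum_ij_iD_i$ with $j_I>0$, such that: $n^{D5}_I-T_I=\sum_\alpha N^\alpha\mathcal K(F^\alpha,F^\alpha,D_I)$ for $I=0,\dots,p$; $\sum_\alpha N^\alpha=16$; and for each $\alpha$, $3\mathcal K(J,J,F^\alpha)=\mathcal K(F^\alpha,F^\alpha,F^\alpha)$ and $\mathcal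 K(J,J,J)>3\mathcal K(J,F^\alpha,F^\alpha)$. Write $m^\alpha=(m_i^\alpha)_{i=1}^p$, a vector in $H^{1,1}(B)$ in the basis $D_i$. A $\gamma$-brane is a stack with $m_0^\gamma=0$. *)

(* Defs.v *)
From HB Require Import structures.
From mathcomp Require Import all_boot all_order all_algebra.
From mathcomp Require Import boolp classical_sets functions cardinality reals.

Set Implicit Arguments.
Unset Strict Implicit.
Unset Printing Implicit Defensive.

Import Order.TTheory GRing.Theory Num.Theory.
Local Open Scope ring_scope.

(* [head 0 s] only serves as a starting value: the result is the maximum       *)
(* (minimum) of the entries of s as soon as s is not empty.                    *)
Definition seq_max (R : realType) (s : seq R) : R :=
  \big[Num.max/head 0 s]_(y <- s) y.
Definition seq_min (R : realType) (s : seq R) : R :=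
  \big[Num.min/head 0 s]_(y <- s) y.

Section Forms.
Variables (R : realType) (p : nat).

Definition bil (G : 'M[R]_p) (u v : 'cV[R]_p) : R := (u^T *m G *m v) 0 0.

(* Signature (1, p - 1) in the sense of Sylvester: some basis, the columns of  *)
(* P, brings the form to diag(1, -1, ..., -1).                                 *)
Definition lorentzian (G : 'M[R]_p) : Prop :=
  G^T = G /\
  exists2 P : 'M[R]_p, P \in unitmx &
    P^T *m G *m P =
      \matrix_(i, j) (if i == j then (if val i == 0%N then 1 else -1) else 0).

Definition psd (M : 'M[R]_p) : Prop :=
  M^T = M /\ forall v : 'cV[R]_p, 0 <= bil M v v.

(* For G of signature (1, p - 1): the half of {v | G(v, v) >= 0} selected by   *)
(* the time orientation t (G(t, t) > 0).                                       *)
Definition closed_light_cone (G : 'M[R]_p) (t v : 'cV[R]_p) : Prop :=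
  0 <= bil G v v /\ 0 <= bil G t v.

End Forms.

(* Numerical data of the base B of the elliptic fibration:                     *)
(*   gram i j = D_i . D_j, c1 = the coordinates b_i of c_1(B) in the basis     *)
(*   D_1, ..., D_p of H^{1,1}(B), c2 = the integral of c_2(B) over B.          *)
(* The b_i are rational because the D_i are integral and form a basis.          *)
Record base_data (p : nat) := BaseData {
  gram : 'M[int]_p;
  c1 : 'cV[rat]_p;
  c2 : int }.

Section Geometry.
Variables (R : realType) (p : nat) (B : base_data p).

Definition Cmx : 'M[R]_p := map_mx intr (gram B).
Definition bvec : 'cV[R]_p := map_mx ratr (c1 B).

Definition K00 (i : 'I_p) : R := \sum_j bvec j 0 * Cmx i j.
Definition K000 : R := \sum_i \sum_j bvec i 0 * bvec j 0 * Cmx i j.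

(* Classes on X are column vectors indexed by 'I_p.+1 in the basis             *)
(* D_0, D_1, ..., D_p: index ord0 stands for D_0 = sigma + pi^* c_1 and index  *)
(* lift ord0 i for the pullback of the class on B of index i : 'I_p.           *)
Definition Kbasis (I J L : 'I_p.+1) : R :=
  match unlift ord0 I, unlift ord0 J, unlift ord0 L with
  | Some _, Some _, Some _ => 0
  | None, Some i, Some j | Some i, None, Some j | Some i, Some j, None =>
      Cmx i j
  | None, None, Some i | None, Some i, None | Some i, None, None => K00 i
  | None, None, None => K000
  end.

Definition Kform (u v w : 'cV[R]_p.+1) : R :=
  \sum_I \sum_J \sum_L u I 0 * v J 0 * w L 0 * Kbasis I J L.

Definition Dclass (I : 'I_p.+1) : 'cV[R]_p.+1 := delta_mx I 0.

(* T_0 = the integral of c_2 + 11 c_1^2, and c_1^2 = K000 *)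
Definition tadpole0 : R := (c2 B)%:~R + 11 * K000.
Definition tadpole (i : 'I_p) : R := 12 * K00 i.
Definition tadpoles (I : 'I_p.+1) : R :=
  if unlift ord0 I is Some i then tadpole i else tadpole0.

Definition Mik (x : R) (i k : 'I_p) : 'M[R]_p :=
  \matrix_(j, l) (x * Cmx i j * Cmx k l + x * Cmx i l * Cmx k j - Cmx j l).

(* Linear independence of D_1, ..., D_p is built in: they are the coordinate   *)
(* vectors delta_mx i 0.                                                       *)
Definition admissible_base : Prop :=
  [/\ (exists2 t : 'cV[R]_p, 0 < bil Cmx t t &
         forall i : 'I_p, closed_light_cone Cmx t (delta_mx i 0)),
      (forall i : 'I_p, 0 <= bvec i 0),
      (forall i : 'I_p, K00 i \is a Num.int /\ 0 < K00 i)
    & lorentzian Cmx].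

(* The numbers x_{i,k} are indexed by the two-element subsets [set i; k].      *)
Definition admissible_x (x : {set 'I_p} -> rat) : Prop :=
  forall i k : 'I_p, i != k ->
    0 < x [set i; k] /\ psd (Mik (ratr (x [set i; k])) i k).

Definition max_x (x : {set 'I_p} -> rat) : R :=
  seq_max [seq ratr (x A) | A in [set A : {set 'I_p} | #|A| == 2%N]].
Definition max_T : R := seq_max [seq tadpole i | i : 'I_p].
Definition min_T : R := seq_min [seq tadpole i | i : 'I_p].

End Geometry.

(* A finite collection of D9-brane stacks, labelled by 'I_nstacks, together    *)
(* with the numbers of D5-branes and the class J. Fluxes are given by their    *)
(* coordinates m_0, m_1, ..., m_p.                                             *)
Record configuration (R : realType) (p : nat) := Configuration {
  nstacks : nat;
  mult : 'I_nstacks -> nat;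
  flux : 'I_nstacks -> 'cV[rat]_p.+1;
  nD5 : 'I_p.+1 -> nat;
  kahler : 'cV[R]_p.+1 }.
Arguments mult {R p} c _.
Arguments flux {R p} c _.

Definition base_flux (p : nat) (m : 'cV[rat]_p.+1) : 'cV[rat]_p :=
  \col_i m (lift ord0 i) 0.

Definition integral_flux (p : nat) (B : base_data p) (m : 'cV[rat]_p.+1) :
    Prop :=
  m ord0 0 \is a Num.int /\
  forall i : 'I_p,
    (\sum_j (gram B i j)%:~R * base_flux m j 0) \is a Num.int.

Section Configurations.
Variables (R : realType) (p : nat) (B : base_data p) (S : configuration R p).

Definition fluxR (a : 'I_(nstacks S)) : 'cV[R]_p.+1 := map_mx ratr (flux S a).
Definition base_fluxR (a : 'I_(nstacks S)) : 'cV[R]_p :=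
  map_mx ratr (base_flux (flux S a)).

Definition tadpole_cancellation : Prop :=
  (forall I : 'I_p.+1,
     (nD5 S I)%:R - tadpoles R B I =
       \sum_a (mult S a)%:R * Kform B (fluxR a) (fluxR a) (Dclass R I)) /\
  (\sum_a mult S a = 16)%N.

Definition susy_stack (a : 'I_(nstacks S)) : Prop :=
  let J := kahler S in let F := fluxR a in
  3 * Kform B J J F = Kform B F F F /\
  3 * Kform B J F F < Kform B J J J.

Definition supersymmetric : Prop :=
  [/\ (forall a, (0 < mult S a)%N),
      (forall a, integral_flux B (flux S a)),
      (forall I, 0 < kahler S I 0),
      tadpole_cancellation
    & forall a, susy_stack a].

Definition gamma_brane (a : 'I_(nstacks S)) : bool := flux S a ord0 0 == 0.

End Configurations.

Arguments fluxR {R p} S a.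
Arguments base_fluxR {R p} S a.
Arguments gamma_brane {R p} S a.

(* Main.v *)
Require Import Defs.
From HB Require Import structures.
From mathcomp Require Import all_boot all_order all_algebra.
From mathcomp Require Import boolp classical_sets functions cardinality reals.
From mathcomp Require Import zify ring lra.
Import Order.TTheory GRing.Theory Num.Theory.
Local Open Scope ring_scope.

(** Write <.,.> for the form C, put g = j + (j_0 / 2) b and, for a stack with
    m_0 <> 0, v = 2 (m + m_0 b) / m_0, with weight w = N m_0^2.  Supersymmetry
    places v on one sheet of a hyperboloid whose centre depends only on m_0 and
    J and whose radius tends to infinity with J.  Two points of one sheet have a
    space-like difference, so <v, v> is concave along the sheet; comparing the
    sheets for different m_0 with their common asymptotic hyperplane
    j_0 <g, v> = - <j, j> gives, with V = sum w v and W = sum w,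

      sum w <v, v> <= <V, V> / W + error,   the error vanishing for J large.

    The tadpole conditions for D_1, ..., D_p say that the numbers V_i = <V, D_i>
    are integers with V_i >= - T_i, while <g, V> <= 0 forces some V_i to be
    negative as soon as one is positive; positivity of the matrices M_{i,k} then
    yields <V, V> <= 2 max x min T max T.  The integer W is 0, or 1, when there
    is a single stack and no error, or at least 2, and then the factor 1 / W
    absorbs the error.  The tadpole condition for D_0 turns this into the upper
    bound.

    On a gamma-brane supersymmetry reads <g, m> = 0 with g time-like.  Hence
    <m, m> <= 0, the integers <m, D_i> vanish or take both signs, and
    positivity of M_{i,k} bounds each of them by a multiple of - <m, m>. *)

(** * Lorentzian forms *)

Section BilinearForm.
Context {R : realType} {p : nat} (G : 'M[R]_p).
Implicit Types u v w : 'cV[R]_p.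

Lemma bilDl u v w : bil G (u + v) w = bil G u w + bil G v w.
Proof. by rewrite /bil linearD /= !mulmxDl mxE. Qed.

Lemma bilDr u v w : bil G u (v + w) = bil G u v + bil G u w.
Proof. by rewrite /bil mulmxDr mxE. Qed.

Lemma bilZl k u v : bil G (k *: u) v = k * bil G u v.
Proof. by rewrite /bil linearZ /= -!scalemxAl mxE. Qed.

Lemma bilZr k u v : bil G u (k *: v) = k * bil G u v.
Proof. by rewrite /bil -scalemxAr mxE. Qed.

Lemma bilNl u v : bil G (- u) v = - bil G u v.
Proof. by rewrite -scaleN1r bilZl mulN1r. Qed.

Lemma bilNr u v : bil G u (- v) = - bil G u v.
Proof. by rewrite -scaleN1r bilZr mulN1r. Qed.

Lemma bil0r u : bil G u 0 = 0.
Proof. by rewrite /bil mulmx0 mxE. Qed.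

Definition bilE := (bilDl, bilDr, bilZl, bilZr, bilNl, bilNr).

Lemma bil_sumr u (I : finType) (P : pred I) (k : I -> R) (v : I -> 'cV[R]_p) :
  bil G u (\sum_(i | P i) k i *: v i) = \sum_(i | P i) k i * bil G u (v i).
Proof.
elim/big_rec2: _ => [|i y x _ <-]; first exact: bil0r.
by rewrite bilDr bilZr.
Qed.

Lemma bil_delta u v : bil G u v = \sum_i v i 0 * bil G u (delta_mx i 0).
Proof.
rewrite -bil_sumr; congr (bil _ _ _).
rewrite {1}[v]matrix_sum_delta; apply: eq_bigr => i _.
by rewrite big_ord1.
Qed.

Hypothesis Gsym : G^T = G.

Lemma bilC u v : bil G u v = bil G v u.
Proof.
rewrite /bil -[in RHS]Gsym.
have -> : v^T *m G^T *m u = (u^T *m G *m v)^T by rewrite !trmx_mul trmxK mulmxA.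
by rewrite [RHS]mxE.
Qed.

(** Parallel-axis identity. It is applied with [r] at, or displaced along [g] from, the weighted
    mean of the [v i]. *)
Lemma sum_bil_shift (I : finType) (P : pred I) (k : I -> R)
    (v : I -> 'cV[R]_p) r :
  \sum_(i | P i) k i * bil G (v i - r) (v i - r) =
  \sum_(i | P i) k i * bil G (v i) (v i)
  - 2 * bil G r (\sum_(i | P i) k i *: v i) + (\sum_(i | P i) k i) * bil G r r.
Proof.
rewrite bil_sumr mulr_sumr mulr_suml -sumrB -big_split /=.
by apply: eq_bigr => i _; rewrite !bilE (bilC (v i) r); ring.
Qed.

(** The metric content of signature (1, p - 1). As [z] is arbitrary, every vector orthogonal to a
    time-like one has non-positive square. *)
Definition reverse_cauchy_schwarz :=
  forall t z, 0 < bil G t t -> bil G t t * bil G z z <= bil G t z ^+ 2.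

Hypothesis rcs : reverse_cauchy_schwarz.

(** The combination of [u] and [v] orthogonal to [t] has non-positive square. Its two diagonal terms
    are non-negative, so the cross term [-2 <t,u> <t,v> <u,v>] cannot be positive. *)
Lemma bil_same_cone t u v :
  0 < bil G t t -> 0 < bil G t u -> 0 < bil G t v ->
  0 <= bil G u u -> 0 <= bil G v v -> 0 <= bil G u v.
Proof.
move=> tt tu tv uu vv.
have := rcs t (bil G t v *: u - bil G t u *: v) tt.
rewrite !bilE (bilC v u).
have -> : bil G t v * bil G t u - bil G t u * bil G t v = 0 by ring.
rewrite expr0n /= pmulr_rle0 // => h.
have tuv := mulr_gt0 tu tv.
suff: 0 <= (bil G t u * bil G t v) * bil G u v by rewrite pmulr_rge0.
have h1 := mulr_ge0 (sqr_ge0 (bil G t v)) uu.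
have h2 := mulr_ge0 (sqr_ge0 (bil G t u)) vv.
rewrite !expr2 in h1 h2.
nra.
Qed.

(* [P] and [Q] lie on corresponding sheets of two hyperboloids centred at 0     *)
(* whose squared radii differ by [f].                                           *)
Lemma bil_hyperboloids_diff g P Q f :
  0 < bil G g g -> 0 < bil G g P -> 0 < bil G g Q -> 0 < bil G P P ->
  0 <= bil G P P + f -> bil G Q Q = bil G P P + f ->
  bil G P P * bil G (Q - P) (Q - P) <= f ^+ 2.
Proof.
move=> gg gP gQ PP f0 QQ.
have t0 : 0 <= bil G P Q.
  by apply: (bil_same_cone g) => //; [exact: ltW | rewrite QQ].
have := rcs P Q PP.
rewrite !bilE (bilC Q P) QQ.
move: t0 PP f0; move: (bil G P Q) (bil G P P) => t r t0 r0 f0 h.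
(* The claim amounts to [(2r - f)(r + f) <= 2rt], while [rcs] gives [t^2 >= r(r + f)]. It is trivial
   if the left side is not positive and follows by squaring otherwise. *)
have [le0|gt0] := lerP ((2 * r - f) * (r + f)) 0.
  by have := mulr_ge0 (ltW r0) t0; nra.
have fr : 0 < 2 * r - f by nra.
have h3 : ((2 * r - f) * (r + f)) ^+ 2 <= (2 * r * t) ^+ 2.
  have h4 : 4 * r ^+ 2 * (r * (r + f)) <= (2 * r * t) ^+ 2.
    have -> : (2 * r * t) ^+ 2 = 4 * r ^+ 2 * t ^+ 2 by ring.
    by apply: ler_wpM2l => //; rewrite mulr_ge0 // sqr_ge0.
  apply: le_trans h4.
  have -> : ((2 * r - f) * (r + f)) ^+ 2 =
     4 * r ^+ 2 * (r * (r + f)) - (r + f) * (f ^+ 2 * (3 * r - f)) by ring.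
  rewrite lerBlDr lerDl mulr_ge0 // mulr_ge0 ?sqr_ge0 //; lra.
have : (2 * r - f) * (r + f) <= 2 * r * t.
  by rewrite -(ler_pXn2r (ltn0Sn 1)) ?nnegrE //;
     [exact: ltW | rewrite !mulr_ge0 // ltW].
nra.
Qed.

End BilinearForm.

Section Lorentzian.
Context {R : realType} {p : nat} (G : 'M[R]_p).

Lemma lorentzian_unitmx : lorentzian G -> G \in unitmx.
Proof.
move=> [_ [P Pu PGP]].
set E := (X in _ = X) in PGP.
have EE : E *m E = 1%:M.
  apply/matrixP => i k; rewrite !mxE (bigD1 i) //= big1 => [|l /negPf li].
    rewrite !mxE eqxx addr0; case: (i == k); case: ifP => _;
    by rewrite ?mulr0 ?mulrNN ?mulr1.
  by rewrite !mxE eq_sym li mul0r.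
have [Eu _] := mulmx1_unit EE.
by move: Eu; rewrite -PGP !unitmx_mul => /andP[/andP[_ ->]].
Qed.

(** In Sylvester's basis [z_0 t - t_0 z] has no time component, hence non-positive square.
    Multiplying by [<t,t>] and adding the square of [z_0 <t,t> - t_0 <t,z>] gives the inequality
    times [t_0^2]. *)
Lemma lorentzian_rcs : lorentzian G -> reverse_cauchy_schwarz G.
Proof.
move=> [_ [P Pu PGP]].
set E := (X in _ = X) in PGP.
have bilP u v : bil G (P *m u) (P *m v) = bil E u v.
  by rewrite /bil -PGP trmx_mul !mulmxA.
have bilEd u v : bil E u v =
    \sum_i (if val i == 0%N then 1 else -1) * (u i 0 * v i 0).
  rewrite /bil -mulmxA mxE; apply: eq_bigr => i _.
  rewrite !mxE (bigD1 i) //= big1 => [|l /negPf li].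
    by rewrite !mxE eqxx addr0 mulrCA.
  by rewrite mxE eq_sym li mul0r.
move=> t z.
rewrite -[t](mulKVmx Pu) -[z](mulKVmx Pu) !bilP.
move: (invmx P *m t) (invmx P *m z) => {}t {}z.
move=> tt; have [p0|p_gt0] := posnP p.
  move: tt; rewrite bilEd big1 ?ltxx // => i _.
  by have := ltn_ord i; rewrite [X in (_ < X)%N]p0.
pose i0 := Ordinal p_gt0.
have neg (u : 'cV[R]_p) : u i0 0 = 0 -> bil E u u <= 0.
  move=> u0; rewrite bilEd; apply: sumr_le0 => i _.
  case: ifP => [/eqP i_0|_]; last by rewrite mulN1r oppr_le0 -expr2 sqr_ge0.
  by rewrite (_ : i = i0) ?u0 ?mul0r ?mulr0 //; apply: val_inj.
have Esym : E^T = E.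
  by apply/matrixP => i k; rewrite !mxE eq_sym; case: eqP => // ->.
have t0 : t i0 0 != 0.
  by apply: contraTneq tt => t0; rewrite -leNgt neg.
have t0gt : 0 < t i0 0 ^+ 2 by rewrite exprn_even_gt0.
have := neg (z i0 0 *: t - t i0 0 *: z).
rewrite !mxE !bilE (bilC _ Esym z t) mulrC subrr => /(_ erefl) => h0.
rewrite -(ler_pM2l t0gt); move: tt h0.
move: (bil E t t) (bil E t z) (bil E z z) (z i0 0) (t i0 0).
move=> x y k l m x0 h.
have h1 := mulr_ge0_le0 (ltW x0) h.
have h2 := sqr_ge0 (l * x - m * y).
nra.
Qed.

End Lorentzian.

(** * The triple intersection form *)

Definition base_part {R : realType} {p : nat} (u : 'cV[R]_p.+1) : 'cV[R]_p :=
  \col_i u (lift ord0 i) 0.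

Section TripleIntersection.
Context {R : realType} {p : nat} (B : base_data p).
Notation C := (Cmx R B).
Notation b := (bvec R B).
Hypothesis Csym : C^T = C.

Lemma bil_delta_mx i k : bil C (delta_mx i 0) (delta_mx k 0) = C i k.
Proof. by rewrite /bil trmx_delta -rowE -colE !mxE. Qed.

Lemma K00E i : K00 R B i = bil C b (delta_mx i 0).
Proof.
rewrite (bilC _ Csym) bil_delta /K00.
by apply: eq_bigr => l _; rewrite bil_delta_mx.
Qed.

Lemma bil_Cmx_sum (u v : 'cV[R]_p) : bil C u v = \sum_i \sum_k u i 0 * v k 0 * C i k.
Proof.
rewrite (bilC _ Csym) bil_delta; apply: eq_bigr => i _.
rewrite (bilC _ Csym) bil_delta mulr_sumr; apply: eq_bigr => k _.
by rewrite bil_delta_mx mulrA.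
Qed.

Lemma K000E : K000 R B = bil C b b.
Proof. by rewrite bil_Cmx_sum. Qed.

Lemma KformE (u v w : 'cV[R]_p.+1) :
  Kform B u v w =
    u 0 0 * v 0 0 * w 0 0 * bil C b b
    + u 0 0 * v 0 0 * bil C b (base_part w) + u 0 0 * w 0 0 * bil C b (base_part v)
    + v 0 0 * w 0 0 * bil C b (base_part u)
    + u 0 0 * bil C (base_part v) (base_part w)
    + v 0 0 * bil C (base_part u) (base_part w)
    + w 0 0 * bil C (base_part u) (base_part v).
Proof.
have bilb (z : 'cV[R]_p.+1) :
    bil C b (base_part z) = \sum_i z (lift ord0 i) 0 * K00 R B i.
  by rewrite bil_delta; apply: eq_bigr => i _; rewrite K00E !mxE.
have bilz (y z : 'cV[R]_p.+1) : bil C (base_part y) (base_part z) =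
    \sum_i \sum_k y (lift ord0 i) 0 * z (lift ord0 k) 0 * C i k.
  rewrite bil_Cmx_sum; apply: eq_bigr => i _; apply: eq_bigr => k _.
  by rewrite !mxE.
rewrite /Kform big_ord_recl /=.
have -> : \sum_J \sum_L u 0 0 * v J 0 * w L 0 * Kbasis R B 0 J L =
    u 0 0 * (v 0 0 * w 0 0 * bil C b b + v 0 0 * bil C b (base_part w)
             + w 0 0 * bil C b (base_part v) + bil C (base_part v) (base_part w)).
  rewrite big_ord_recl /= big_ord_recl /= /Kbasis !unlift_none.
  rewrite -K000E (bilb w) (bilb v) bilz !mulrDr -!addrA.
  congr (_ + _); first by ring.
  rewrite !mulr_sumr; congr (_ + _).
    by apply: eq_bigr => i _; rewrite liftK; ring.
  rewrite -big_split; apply: eq_bigr => i _ /=.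
  rewrite big_ord_recl /= liftK unlift_none; move: (K00 R B i) => K00i.
  rewrite mulr_sumr; congr (_ + _).
    by ring.
  by apply: eq_bigr => k _; rewrite liftK; ring.
have -> : \sum_(i < p) \sum_J \sum_L
      u (lift ord0 i) 0 * v J 0 * w L 0 * Kbasis R B (lift ord0 i) J L =
    v 0 0 * w 0 0 * bil C b (base_part u)
    + v 0 0 * bil C (base_part u) (base_part w)
    + w 0 0 * bil C (base_part u) (base_part v).
  rewrite bilb !bilz !mulr_sumr -!big_split; apply: eq_bigr => i _ /=.
  rewrite big_ord_recl /= big_ord_recl /= /Kbasis !unlift_none !liftK.
  move: (K00 R B i) => K00i.
  rewrite !mulr_sumr -!addrA; congr (_ + _); first by ring.
  congr (_ + _).
    by apply: eq_bigr => k _; rewrite liftK; ring.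
  apply: eq_bigr => k _ /=.
  rewrite big_ord_recl /= liftK unlift_none big1 ?addr0 => [|l _].
    by ring.
  by rewrite liftK mulr0.
by ring.
Qed.
End TripleIntersection.

(** * Concavity for the stacks with m_0 <> 0 *)

(* Below, [A], [B], [c], [a], [be] stand for <j,j>, <j,b>, <b,b>, <g,g>, <g,b>, *)
(* and [x], [y] for <g,v-b>, <v-b,v-b>, with [s = m_0 ^ 2] and [w = N * s].     *)
Section ScalarEstimates.
Context {R : realType}.
Implicit Types A B c D s w x y : R.

(** Eliminating [y] between the supersymmetry equation and the inequality factors the latter as
    [(j0^2 + s)(3 j0 x + j0^2 c / 2) < 0]. This is how the inequality selects one sheet. *)
Lemma susy_gy_neg j0 s a c x y :
  0 < j0 -> 1 <= s ->
  j0 * x = - (a + c * j0 ^+ 2 / 4 - s * c / 12) + s * y / 4 ->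
  3 * (j0 * s * c / 4 + j0 * s * y / 4 + s * x)
    < j0 ^+ 3 * c / 4 + 3 * j0 * a ->
  x < - (c * j0 / 6).
Proof.
move=> j0_gt0 s1 e h.
have h2 : (j0 ^+ 2 + s) * (3 * (j0 * x) + j0 ^+ 2 * c / 2) < 0.
  suff -> : (j0 ^+ 2 + s) * (3 * (j0 * x) + j0 ^+ 2 * c / 2) =
      j0 * (3 * (j0 * s * c / 4 + j0 * s * y / 4 + s * x)
            - (j0 ^+ 3 * c / 4 + 3 * j0 * a)).
    by rewrite pmulr_rlt0 // subr_lt0.
  have -> : y = 4 * (j0 * x + (a + c * j0 ^+ 2 / 4 - s * c / 12)) / s.
    by rewrite e; field; lra.
  by field; lra.
have js : 0 < j0 ^+ 2 + s by rewrite ltr_wpDl ?sqr_ge0 //; lra.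
move: h2; rewrite pmulr_rlt0 // => h2.
suff: 0 < j0 * (- (c * j0 / 6) - x) by rewrite pmulr_rgt0 // subr_gt0.
nra.
Qed.

(** By the last equation the left side is [- A + s c / 12 + s y / 4]. The tadpole bound
    [w |x| <= 12 be] controls [s c] through the lower bound on [|x|], and [s y] through
    [a y <= x^2]; for large [D] both are at most [A]. *)
Lemma susy_gv_neg j0 s w c A B D x y :
  let a := A + j0 * B + j0 ^+ 2 * c / 4 in
  let be := B + j0 * c / 2 in
  0 < c -> 0 <= B -> 200 * (1 + c) <= D -> D <= j0 -> D <= A -> D * B <= A ->
  1 <= s -> s <= w -> x < - (c * j0 / 6) -> - (12 * be) <= w * x ->
  a * y <= x ^+ 2 ->
  j0 * x = - (a + c * j0 ^+ 2 / 4 - s * c / 12) + s * y / 4 ->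
  j0 * (x + be) <= - (A / 2).
Proof.
move=> a be c0 B0 cD Dj DA DB s1 sw xneg wx axy e.
have A0 : 0 < A by lra.
have j00 : 0 < j0 by lra.
have a0 : 0 < a.
  by rewrite /a; have := mulr_ge0 (ltW j00) B0;
     have := mulr_gt0 (exprn_gt0 2 j00) c0; lra.
have be0 : 0 <= be by rewrite addr_ge0 // mulr_ge0 ?invr_ge0 ?mulr_ge0 //; lra.
have xle0 : x <= 0.
  by have := mulr_gt0 c0 j00; lra.
have B200 : 200 * B <= A by nra.
have scj : s * c * j0 <= 72 * be.
  have : s * (c * j0 / 6) <= w * (- x).
    by apply: ler_pM => //; nra.
  by lra.
have sc : s * c <= A * (3/4).
  rewrite -(ler_pM2r j00); apply: (le_trans scj); rewrite /be.
  have : 72 * B <= (72/200) * A * j0.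
    have : A <= A * j0 by rewrite ler_peMr //; lra.
    by lra.
  have : 36 * c * j0 <= (36/200) * A * j0.
    by rewrite ler_pM2r //; lra.
  by lra.
have say : a * (s * y) <= 144 * be ^+ 2.
  have h1 : s * (a * y) <= s * x ^+ 2 by rewrite ler_pM2l //; lra.
  have h2 : s * x ^+ 2 <= (w * x) ^+ 2.
    rewrite exprMn ler_wpM2r ?sqr_ge0 // expr2; nra.
  have h3 : (w * x) ^+ 2 <= (12 * be) ^+ 2.
    rewrite -sqrrN ler_pXn2r // ?nnegrE ?mulr_ge0 -?mulrN ?mulr_ge0 //; lra.
  have -> : 144 * be ^+ 2 = (12 * be) ^+ 2 by ring.
  by apply: le_trans h3; apply: le_trans h2; rewrite mulrCA.
have sy : s * y <= A.
  rewrite -(ler_pM2l a0); apply: (le_trans say).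
  have h1 : 144 * B ^+ 2 <= A ^+ 2 by nra.
  have h2 : 144 * c <= A by lra.
  have h3 : 144 * c * (j0 * B + j0 ^+ 2 * c / 4) <= A * (j0 * B + j0 ^+ 2 * c / 4).
    apply: ler_wpM2r => //; by rewrite addr_ge0 ?mulr_ge0 ?sqr_ge0 ?invr_ge0 // ltW.
  rewrite /be /a; nra.
rewrite mulrDr e /a /be; lra.
Qed.

(** Here [f] is the defect at the comparison point and [u] the size of the square of the mean. The
    part of [f] growing with [u] is absorbed by [e (1 + u)], because [j0^2 a] is large; the part
    proportional to [th] is absorbed by [th^2 a], because [be] is small against [a]. *)
Lemma chord_error_small j0 a be th u f D e k1 k5 :
  0 < e -> 0 <= k1 -> 0 <= k5 ->
  (36 * k1) ^+ 2 * k5 <= e * D -> 12 ^+ 2 * (k1 * k5 + 36 ^+ 2) <= D ->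
  D <= j0 -> 1 <= a -> 0 <= be -> D * be <= 2 * a -> `|th| * a <= 33 * be ->
  0 <= u -> 1 + u <= k5 * a -> `|f| <= k1 * (1 + u) + 9 * `|th| * be ->
  12 ^+ 2 * `|f| <= j0 ^+ 2 * a /\
  (24 * f) ^+ 2 <= j0 ^+ 2 * a * (th ^+ 2 * a + e * (1 + u)).
Proof.
move=> e0 k10 k50 De Dk Dj a1 be0 Dbe tha u0 uk5 fle.
have kk := mulr_ge0 k10 k50.
have D1 : 2 * 20 ^+ 2 <= D by lra.
have a0 : 0 < a by lra.
have j00 : 0 < j0 by lra.
have Da : D * a <= j0 ^+ 2 * a.
  by rewrite ler_pM2r // expr2; apply: (le_trans Dj); rewrite ler_peMr; lra.
have be_a : 20 * (20 * be) <= a.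
  by apply: le_trans (_ : D * be / 2 <= _); [have := ler_wpM2r be0 D1; lra | lra].
have t0 : 0 <= `|th| by [].
have tb0 := mulr_ge0 t0 be0.
have tb : 9 * (`|th| * be) <= 36 ^+ 2 * a.
  rewrite -(ler_pM2r a0).
  have : `|th| * a * be <= 33 * be * be by exact: ler_wpM2r.
  by nra.
have ku : k1 * (1 + u) <= k1 * k5 * a by rewrite -mulrA ler_wpM2l.
split.
  have : 12 ^+ 2 * (k1 * k5 + 36 ^+ 2) * a <= D * a by rewrite ler_pM2r.
  by lra.
have h1 : f ^+ 2 <= 2 * (k1 * (1 + u)) ^+ 2 + 2 * (9 * (`|th| * be)) ^+ 2.
  have h0 : 0 <= k1 * (1 + u) by rewrite mulr_ge0 // addr_ge0.
  have : `|f| ^+ 2 <= (k1 * (1 + u) + 9 * `|th| * be) ^+ 2.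
    by rewrite ler_pXn2r // ?nnegrE // -mulrA addr_ge0 // mulr_ge0.
  rewrite real_normK ?num_real // => h.
  have := sqr_ge0 (k1 * (1 + u) - 9 * (`|th| * be)).
  nra.
(* The constant 36 comes from [2 * 24 ^ 2 <= 36 ^ 2], the factor 2 being that of [h1]. *)
have h2 : (36 * (k1 * (1 + u))) ^+ 2 <= j0 ^+ 2 * a * (e * (1 + u)).
  have u1 : 0 <= 1 + u by lra.
  have h : (36 * k1) ^+ 2 * (1 + u) <= e * (j0 ^+ 2 * a).
    apply: le_trans (_ : (36 * k1) ^+ 2 * (k5 * a) <= _).
      by rewrite ler_wpM2l ?sqr_ge0.
    apply: le_trans (_ : e * D * a <= _).
      by rewrite mulrA ler_pM2r.
    by rewrite -mulrA ler_pM2l.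
  have := ler_wpM2r u1 h; rewrite exprMn; nra.
have h3 : 2 * (24 * (9 * (`|th| * be))) ^+ 2 <= j0 ^+ 2 * a * (th ^+ 2 * a).
  have -> : 2 * (24 * (9 * (`|th| * be))) ^+ 2 =
      2 * (24 * 9 * be) ^+ 2 * `|th| ^+ 2 by ring.
  rewrite real_normK ?num_real //.
  have -> : j0 ^+ 2 * a * (th ^+ 2 * a) = (j0 ^+ 2 * a ^+ 2) * th ^+ 2 by ring.
  apply: ler_wpM2r; first exact: sqr_ge0.
  have hb : (20 * (20 * be)) ^+ 2 <= a ^+ 2.
    by rewrite ler_pXn2r // ?nnegrE ?mulr_ge0 //; exact: ltW.
  have h1j : 1 <= j0 ^+ 2 by rewrite exprn_ege1 //; lra.
  have h1a : a ^+ 2 <= j0 ^+ 2 * a ^+ 2 by rewrite ler_peMl // sqr_ge0.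
  have b2 := sqr_ge0 be.
  lra.
have k2 := sqr_ge0 (k1 * (1 + u)).
by rewrite mulrDr; lra.
Qed.

End ScalarEstimates.

Section StackFamily.
Context {R : realType} {p : nat} (G : 'M[R]_p).
Hypothesis Gsym : G^T = G.
Hypothesis rcs : reverse_cauchy_schwarz G.
(* [k i] stands for N * m_0 ^ 2 and [s i] for m_0 ^ 2.                          *)
Context {I : finType} (P : pred I) (k : I -> nat) (s : I -> R).
Context (v : I -> 'cV[R]_p) (b j : 'cV[R]_p) (j0 D : R).

Local Notation q := (bil G).
Local Notation w i := ((k i)%:R : R).

Let g := j + (j0 / 2) *: b.
Let W := \sum_(i | P i) w i.
Let V := \sum_(i | P i) w i *: v i.

(** Supersymmetry reads [<j,j> + j0 <g,v> = m_0^2 * susy_defect v]. On the asymptotic hyperplane the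
    left side vanishes, so there this quantity measures the failure to lie on the quadric. *)
Definition susy_defect (u : 'cV[R]_p) := q b b / 3 - q b u / 2 + q u u / 4.

Hypothesis c_gt0 : 0 < q b b.
Hypothesis jb_ge0 : 0 <= q j b.
Hypothesis D_c : 200 * (1 + q b b) <= D.
Hypothesis D_j0 : D <= j0.
Hypothesis D_jj : D <= q j j.
Hypothesis D_jb : D * q j b <= q j j.
Hypothesis s_ge1 : forall i, P i -> 1 <= s i.
Hypothesis s_le : forall i, P i -> s i <= w i.
Hypothesis susyE : forall i, P i ->
  q j j + j0 * q g (v i) = s i * susy_defect (v i).
Hypothesis susyI : forall i, P i ->
  3 * (j0 * s i * q b b / 4 + j0 * s i * q (v i - b) (v i - b) / 4
       + s i * q g (v i - b)) < j0 ^+ 3 * q b b / 4 + 3 * j0 * q g g.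
Hypothesis tad : - (12 * q g b) <= \sum_(i | P i) w i * q g (v i - b).

Let D_gt0 : 0 < D. Proof. by move: c_gt0 D_c; lra. Qed.
Let j0_gt0 : 0 < j0. Proof. exact: lt_le_trans D_gt0 D_j0. Qed.
Let jj_gt0 : 0 < q j j. Proof. exact: lt_le_trans D_gt0 D_jj. Qed.

Let gg : q g g = q j j + j0 * q j b + j0 ^+ 2 * q b b / 4.
Proof. by rewrite /g !bilE (bilC _ Gsym b j); field. Qed.
Let gb : q g b = q j b + j0 * q b b / 2.
Proof. by rewrite /g !bilE; ring. Qed.

Let gg_ge : q j j <= q g g.
Proof.
have := mulr_ge0 (ltW j0_gt0) jb_ge0.
have := mulr_gt0 (exprn_gt0 2 j0_gt0) c_gt0.
by rewrite gg; lra.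
Qed.
Let gg_gt0 : 0 < q g g. Proof. exact: lt_le_trans jj_gt0 gg_ge. Qed.
Let gb_gt0 : 0 < q g b.
Proof. by rewrite gb ltr_wpDl // divr_gt0 // mulr_gt0. Qed.

Let gvE u : q g u = q g (u - b) + q g b.
Proof. by rewrite bilDr bilNr addrNK. Qed.
Let yyE u : q (u - b) (u - b) = q u u - 2 * q b u + q b b.
Proof. by rewrite !bilE (bilC _ Gsym u b); ring. Qed.

Let susy_y i : P i ->
  j0 * q g (v i - b) =
    - (q g g + q b b * j0 ^+ 2 / 4 - s i * q b b / 12)
    + s i * q (v i - b) (v i - b) / 4.
Proof.
move=> Pi; have := susyE i Pi; rewrite yyE /susy_defect gvE gg gb; lra.
Qed.

Let gy_neg i : P i -> q g (v i - b) < - (q b b * j0 / 6).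
Proof.
move=> Pi; exact: susy_gy_neg j0_gt0 (s_ge1 i Pi) (susy_y i Pi) (susyI i Pi).
Qed.

(** All summands in [tad] are negative, so each of them is at least the whole sum. *)
Let gy_ge i : P i -> - (12 * q g b) <= w i * q g (v i - b).
Proof.
move=> Pi; apply: (le_trans tad); rewrite (bigD1 i) //= gerDl.
apply: sumr_le0 => l /andP[Pl _]; rewrite mulr_ge0_le0 //.
by have := gy_neg l Pl; have := mulr_gt0 c_gt0 j0_gt0; lra.
Qed.

Lemma stack_gv_le i : P i -> j0 * q g (v i) <= - (q j j / 2).
Proof.
move=> Pi; rewrite gvE [X in _ + X]gb.
apply: (@susy_gv_neg _ j0 (s i) (w i) (q b b) (q j j) (q j b) D
   (q g (v i - b)) (q (v i - b) (v i - b))) => //.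
- exact: s_ge1.
- exact: s_le.
- exact: gy_neg.
- by rewrite -gb; exact: gy_ge.
- by rewrite -gg; exact: rcs.
- by rewrite -gg; exact: susy_y.
Qed.

Lemma stack_gv_lt0 i : P i -> q g (v i) < 0.
Proof.
move=> /stack_gv_le h.
suff : j0 * q g (v i) < 0 by rewrite pmulr_rlt0.
by move: jj_gt0 h; lra.
Qed.

Let gv_ge i : P i -> - (11 * q g b) <= q g (v i).
Proof.
move=> Pi; rewrite (gvE (v i)).
have y0 : q g (v i - b) <= 0.
  by have := gy_neg i Pi; have := mulr_gt0 c_gt0 j0_gt0; lra.
have w1 : 1 <= w i by exact: le_trans (s_ge1 i Pi) (s_le i Pi).
have := ler_wnM2r y0 w1; have := gy_ge i Pi; lra.
Qed.

Let gVE : q g V = \sum_(i | P i) w i * q g (v i).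
Proof. exact: bil_sumr. Qed.

Lemma stack_gV_le0 : q g V <= 0.
Proof.
by rewrite gVE; apply: sumr_le0 => i Pi; rewrite mulr_ge0_le0 // ltW ?stack_gv_lt0.
Qed.

(** Shifting by [b] in [tad] gives [<g,V> >= (W - 12) <g,b>], while [<g,V> < 0] as soon as there is
    a stack. *)
Lemma stack_W_lt : W < 12.
Proof.
have [i Pi|P0] := pickP P; last by rewrite /W big_pred0.
have hs' : q g V < 0.
  rewrite gVE (bigD1 i) //= ltr_wnDr //.
    apply: sumr_le0 => l /andP[Pl _].
    by rewrite mulr_ge0_le0 // ltW ?stack_gv_lt0.
  rewrite pmulr_rlt0 ?stack_gv_lt0 //.
  exact: lt_le_trans ltr01 (le_trans (s_ge1 i Pi) (s_le i Pi)).
move: hs'.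
have -> : q g V = \sum_(i | P i) w i * q g (v i - b) + W * q g b.
  rewrite gVE mulr_suml -big_split; apply: eq_bigr => l _ /=.
  by rewrite -mulrDr -gvE.
by move: tad => h1 h2; rewrite -(ltr_pM2r gb_gt0); lra.
Qed.

(** Affine images of [v i] and [r] lie on sheets of two hyperboloids centred at 0 whose squared
    radii differ by [4 s_i^2 * susy_defect r], so [bil_hyperboloids_diff] applies. The 24 is 2 times
    the bound 12 on [s i]. *)
Lemma stack_chord i r :
  P i -> j0 * q g r = - q j j ->
  12 ^+ 2 * `|susy_defect r| <= j0 ^+ 2 * q g g ->
  j0 ^+ 2 * q g g * q (v i - r) (v i - r) <= (24 * susy_defect r) ^+ 2.
Proof.
move=> Pi gr Phi_le.
have s1 := s_ge1 i Pi; have s12 : s i <= 12.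
  apply: (le_trans (s_le i Pi)); apply: ltW; apply: le_lt_trans stack_W_lt.
  by rewrite /W (bigD1 i) //= lerDl sumr_ge0.
have ev := susyE i Pi.
have X0 : 0 < j0 ^+ 2 * q g g by rewrite mulr_gt0 // exprn_gt0.
move: (s i) ev s1 s12 => t ev s1 s12.
have t0 : 0 < t by lra.
have [kk kkD] : exists u, u = j0 *: g + (t / 2) *: b.
  by exists (j0 *: g + (t / 2) *: b).
pose Pv := 2 *: kk - t *: v i.
pose Qv := 2 *: kk - t *: r.
have kkE u : q kk u = j0 * q g u + t / 2 * q b u by rewrite kkD bilDl !bilZl.
have kkEr u : q u kk = j0 * q u g + t / 2 * q u b.
  by rewrite kkD bilDr !bilZr.
have PP : q Pv Pv = 4 * q kk kk + 4 * t * (q j j - t * q b b / 3).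
  have -> : q Pv Pv = 4 * q kk kk - 4 * t * q kk (v i) + t ^+ 2 * q (v i) (v i).
    by rewrite /Pv !bilE (bilC _ Gsym (v i) kk); ring.
  rewrite [q kk (v i)]kkE.
  have -> : j0 * q g (v i) = t * susy_defect (v i) - q j j by rewrite -ev; ring.
  by rewrite /susy_defect; field.
have QQ : q Qv Qv = q Pv Pv + 4 * t ^+ 2 * susy_defect r.
  have -> : q Qv Qv = 4 * q kk kk - 4 * t * q kk r + t ^+ 2 * q r r.
    by rewrite /Qv !bilE (bilC _ Gsym r kk); ring.
  by rewrite PP [q kk r]kkE gr /susy_defect; field.
have gk : 0 < q g kk.
  by rewrite kkEr addr_gt0 // mulr_gt0 // divr_gt0.
have PPge : 4 * (j0 ^+ 2 * q g g) <= q Pv Pv.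
  have -> : q Pv Pv = 4 * (j0 ^+ 2 * q g g) + 4 * (j0 * t * q g b)
      + t ^+ 2 * q b b + 4 * t * (q j j - t * q b b / 3).
    by rewrite PP [q kk kk]kkE !kkEr (bilC _ Gsym b g); field.
  have h1 : 0 <= j0 * t * q g b by rewrite !mulr_ge0 // ltW.
  have h2 : 0 <= t ^+ 2 * q b b by rewrite mulr_ge0 ?sqr_ge0 // ltW.
  have h3 : 0 <= t * (q j j - t * q b b / 3).
    rewrite mulr_ge0 ?(ltW t0) //.
    have : t * q b b <= 12 * q b b by rewrite ler_pM2r.
    by move: D_c D_jj c_gt0; lra.
  by lra.
have PP0 : 0 < q Pv Pv by apply: lt_le_trans PPge; rewrite mulr_gt0.
have ft : t ^+ 2 * `|susy_defect r| <= j0 ^+ 2 * q g g.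
  apply: le_trans Phi_le; apply: ler_wpM2r => //.
  by rewrite ler_pXn2r // nnegrE; lra.
have := @bil_hyperboloids_diff _ _ _ Gsym rcs g Pv Qv
  (4 * t ^+ 2 * susy_defect r) gg_gt0.
have gP : 0 < q g Pv.
  rewrite /Pv bilDr bilNr !bilZr subr_gt0 (lt_trans (_ : _ < 0)) ?mulr_gt0 //.
  by rewrite pmulr_rlt0 // stack_gv_lt0.
have gQ : 0 < q g Qv.
  rewrite /Qv bilDr bilNr !bilZr subr_gt0 (lt_trans (_ : _ < 0)) ?mulr_gt0 //.
  rewrite pmulr_rlt0 //.
  suff : j0 * q g r < 0 by rewrite pmulr_rlt0.
  by rewrite gr oppr_lt0.
move=> /(_ gP gQ PP0).
have Pf : 0 <= q Pv Pv + 4 * t ^+ 2 * susy_defect r.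
  have h4 : - `|susy_defect r| <= susy_defect r by rewrite lerNl ler_normr lexx orbT.
  have := ler_wpM2l (sqr_ge0 t) h4; lra.
move=> /(_ Pf QQ).
have -> : Qv - Pv = t *: (v i - r).
  by rewrite /Qv /Pv scalerBr opprB addrC addrA subrK.
rewrite bilZl bilZr => h.
have [neg|pos] := lerP (q (v i - r) (v i - r)) 0.
  apply: le_trans (_ : 0 <= _); first by rewrite pmulr_rle0.
  exact: sqr_ge0.
have h5 : 4 * (j0 ^+ 2 * q g g) * (t ^+ 2 * q (v i - r) (v i - r))
    <= (4 * t ^+ 2 * susy_defect r) ^+ 2.
  apply: le_trans h; rewrite [t * (t * _)]mulrA -expr2.
  by apply: ler_wpM2r => //; rewrite mulr_ge0 ?sqr_ge0 // ltW.
have t2 : 0 < t ^+ 2 by rewrite exprn_gt0.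
have h6 : j0 ^+ 2 * q g g * q (v i - r) (v i - r)
    <= 4 * t ^+ 2 * susy_defect r ^+ 2.
  rewrite -(ler_pM2l (mulr_gt0 (ltr0n _ 4) t2)).
  by move: h5; rewrite !exprMn; congr (_ <= _); ring.
apply: (le_trans h6); rewrite [leRHS]exprMn; apply: ler_wpM2r; first exact: sqr_ge0.
have : t ^+ 2 <= 12 ^+ 2 by rewrite ler_pXn2r // nnegrE; lra.
by lra.
Qed.

Let D_gb : D * q g b <= 2 * q g g.
Proof.
have h := ler_wpM2r (mulr_ge0 (ltW j0_gt0) (ltW c_gt0)) D_j0.
have h2 := mulr_ge0 (ltW j0_gt0) jb_ge0.
by rewrite gg gb mulrDr; move: h h2 D_jb D_jj D_gt0; lra.
Qed.

Let bil_sqDZ x y t :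
  q (x + t *: y) (x + t *: y) = q x x + 2 * t * q y x + t ^+ 2 * q y y.
Proof. by rewrite !bilE (bilC _ Gsym x y); ring. Qed.

Let mean_gv vm : 0 < W -> V = W *: vm -> - (11 * q g b) <= q g vm <= 0.
Proof.
move=> W0 VE; have gvW : q g V = W * q g vm by rewrite VE bilZr.
apply/andP; split; last first.
  by rewrite -(pmulr_rle0 _ W0) -gvW stack_gV_le0.
rewrite -(ler_pM2l W0) -gvW gVE mulr_suml.
by apply: ler_sum => i Pi; rewrite ler_wpM2l //; exact: gv_ge.
Qed.

Section Concavity.
Context (vm : 'cV[R]_p) (i0 : I) (e k0 k1 k5 u : R).
Hypothesis Pi0 : P i0.
Hypothesis W_ge2 : 2 <= W.
Hypothesis e_gt0 : 0 < e.
Hypothesis k0_ge0 : 0 <= k0.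
Hypothesis k1E : k1 = q b b + 6 * k0 + 1.
Hypothesis k5_ge : 1 + u <= k5 * q g g.
Hypothesis D_e : (36 * k1) ^+ 2 * k5 <= e * D.
Hypothesis D_k : 12 ^+ 2 * (k1 * k5 + 36 ^+ 2) <= D.
Hypothesis VE : V = W *: vm.
Hypothesis uE : u = `|q vm vm|.
Hypothesis bV : `|q b V| <= k0 * (1 + `|q V V|).

(* Comparison with the point [vm + th *: g] of the hyperplane              *)
(* [j0 <g, .> = - <j, j>]; the shift by [th] costs [th ^+ 2 * <g, g>],        *)
(* which pays for the part of the error depending on [th].                    *)
Lemma stack_concave :
  \sum_(i | P i) w i * q (v i) (v i) <= W * (q vm vm + e * (1 + u)).
Proof.
have W0 : 0 < W by exact: lt_le_trans W_ge2.
have /andP[gvm_ge gvm_le] := mean_gv vm W0 VE.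
(* A single stack confines [j0 <g,v>] between [- 11 j0 <g,b>] and [- <j,j> / 2], so the height [- L]
   of the hyperplane is of the order of [<g,b>] at most. *)
have jj_le : q j j <= 22 * q g b * j0.
  have := stack_gv_le i0 Pi0; have := ler_wpM2l (ltW j0_gt0) (gv_ge i0 Pi0).
  by lra.
pose L := q j j / j0.
have Lj : j0 * L = q j j by rewrite /L mulrC divfK // gt_eqF.
have L0 : 0 <= L by rewrite divr_ge0 // ltW.
have Lle : L <= 22 * q g b by rewrite ler_pdivrMr.
pose th := - (L + q g vm) / q g g.
have thE : th * q g g = - (L + q g vm) by rewrite divfK // gt_eqF.
have thn : `|th| * q g g <= 33 * q g b.
  rewrite -[X in _ * X](gtr0_norm gg_gt0) -normrM thE normrN.
  by rewrite ler_norml; move: L0 Lle gvm_le gvm_ge gb_gt0; lra.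
pose r := vm + th *: g.
have gr : j0 * q g r = - q j j.
  by rewrite bilDr bilZr thE -Lj; ring.
have bvm : `|q b vm| <= 12 * k0 * (1 + u).
  have W12 := ltW stack_W_lt.
  have qVV : `|q V V| = W ^+ 2 * u.
    rewrite uE [in LHS]VE bilZl bilZr !normrM (gtr0_norm W0); ring.
  move: bV; rewrite qVV [in q b V]VE bilZr normrM (gtr0_norm W0) => h.
  rewrite -(ler_pM2l W0); apply: (le_trans h).
  have u0 : 0 <= u by rewrite uE.
  have -> : W * (12 * k0 * (1 + u)) = k0 * (12 * W + 12 * W * u) by ring.
  apply: ler_wpM2l => //; apply: lerD; first by move: W_ge2; lra.
  by rewrite expr2 ler_wpM2r // ler_pM2r.
have defr : `|susy_defect r| <= k1 * (1 + u) + 9 * `|th| * q g b.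
  have -> : susy_defect r = q b b / 3 - q b vm / 2 + q vm vm / 4
       + th * ((q g vm - L) / 4 - q g b / 2).
    rewrite /susy_defect bil_sqDZ bilDr bilZr (bilC _ Gsym b g).
    by have := thE; move: (q g g) => x hx; have -> : L = - (th * x) - q g vm;
      [lra | field].
  apply: (le_trans (ler_normD _ _)); apply: lerD.
    have u0 : 0 <= u by rewrite uE.
    have := mulr_ge0 (ltW c_gt0) u0; have := mulr_ge0 k0_ge0 u0.
    have : q vm vm <= u by rewrite uE ler_norm.
    have : - u <= q vm vm by rewrite uE lerNl -normrN ler_norm.
    move: bvm; rewrite k1E ler_norml => /andP[].
    by rewrite ler_norml; move: k0_ge0 c_gt0 u0; lra.
  rewrite normrM -mulrA [leRHS]mulrCA; apply: ler_wpM2l => //.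
  by rewrite ler_norml; move: L0 Lle gvm_le gvm_ge gb_gt0; lra.
have D1 : 1 <= q g g.
  by apply: le_trans gg_ge; move: D_jj D_c c_gt0; lra.
have u0 : 0 <= u by rewrite uE.
have k10 : 0 <= k1 by rewrite k1E; move: k0_ge0 c_gt0; lra.
have k50 : 0 <= k5.
  by rewrite -(pmulr_lge0 _ gg_gt0); apply: le_trans k5_ge; rewrite addr_ge0.
have [C1 C2] := @chord_error_small _ j0 (q g g) (q g b) th u (susy_defect r) D e
  k1 k5 e_gt0 k10 k50 D_e D_k D_j0 D1 (ltW gb_gt0) D_gb thn u0 k5_ge defr.
have X0 : 0 < j0 ^+ 2 * q g g by rewrite mulr_gt0 // exprn_gt0.
have chord i : P i -> q (v i - r) (v i - r) <= th ^+ 2 * q g g + e * (1 + u).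
  move=> Pi; rewrite -(ler_pM2l X0).
  by apply: le_trans C2; exact: stack_chord.
have : \sum_(i | P i) w i * q (v i - r) (v i - r)
    <= W * (th ^+ 2 * q g g + e * (1 + u)).
  by rewrite mulr_suml; apply: ler_sum => i Pi; rewrite ler_wpM2l // chord.
(* Since [<r,r> - 2 <r,vm> = th^2 <g,g> - <vm,vm>], the terms [th^2 <g,g>] on the two sides
   cancel. *)
rewrite (sum_bil_shift _ Gsym) -/V -/W [in q r V]VE bilZr.
rewrite bil_sqDZ bilDl bilZl.
by lra.
Qed.

End Concavity.

(** The constant [k5] bounds [1 + |<vm,vm>|] in units of [<g,g>], where [vm] is the mean [V / W];
    [k1] bounds the defect at [vm] in units of [1 + |<vm,vm>|]. The error rate [e] satisfies
    [12 e (1 + 2M) = M], with 12 the bound on [W]. *)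
Lemma stack_bound M k0 t0 :
  0 < M -> 0 <= k0 -> 0 <= t0 ->
  let k1 := q b b + 6 * k0 + 1 in
  let k5 := 22 ^+ 2 + 1 + 2 * M + 4 * t0 in
  let e := M / (12 * (1 + 2 * M)) in
  (36 * k1) ^+ 2 * k5 <= e * D -> 12 ^+ 2 * (k1 * k5 + 36 ^+ 2) <= D ->
  (forall i, P i -> (0 < k i)%N) ->
  q V V <= 2 * M -> `|q b V| <= k0 * (1 + `|q V V|) ->
  - (4 * t0) <= \sum_(i | P i) w i * q (v i) (v i) ->
  \sum_(i | P i) w i * q (v i) (v i) <= 2 * M.
Proof.
move=> M0 k00 t00 k1 k5 e De Dk k_gt0 VV bV low.
have Wn : W = (\sum_(i | P i) k i)%N%:R by rewrite natr_sum.
have [i0 Pi0|P0] := pickP P; last first.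
  by rewrite big_pred0 // mulr_ge0 // ltW.
(* Total weight 1 means a single stack with [V = v], so the bound on [<V,V>] is already the
   claim. *)
have [W1|W2] := leqP (\sum_(i | P i) k i) 1.
  have := k_gt0 i0 Pi0; move: W1; rewrite (bigD1 i0) //= => W1 k0_gt0.
  have k01 : k i0 = 1%N.
    by apply: anti_leq; rewrite k0_gt0 (leq_trans (leq_addr _ _) W1).
  have only i : P i && (i != i0) = false.
    apply/negP => /andP[Pi ii0]; move: W1; rewrite (bigD1 i) /= ?Pi //.
    rewrite addnA => h.
    by have := leq_trans (leq_trans (leq_add k0_gt0 (k_gt0 i Pi)) (leq_addr _ _)) h.
  move: VV; rewrite /V (bigD1 i0) //= big_pred0 // (bigD1 i0) //= big_pred0 //.
  by rewrite k01 scale1r !addr0 mul1r.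
have W_ge2 : 2 <= W by rewrite Wn (ler_nat _ 2).
have W0 : 0 < W by exact: lt_le_trans W_ge2.
have [vm VE] : exists u, V = W *: u.
  by exists (W^-1 *: V); rewrite scalerA divff ?scale1r // gt_eqF.
have /andP[gvm_ge gvm_le] := mean_gv vm W0 VE.
have D1 : 1 <= q g g.
  by apply: le_trans gg_ge; move: D_jj D_c c_gt0; lra.
have up : W ^+ 2 * q vm vm <= 2 * M.
  by move: VV; rewrite VE bilZl bilZr mulrA.
(* An a priori bound on how space-like the mean can be: [rcs] bounds each [<v_i - vm, v_i - vm>]
   from above, and [low] bounds the weighted sum of the [<v_i,v_i>] from below. *)
have dn : - (4 * t0 + 22 ^+ 2 * q g g) <= q vm vm.
  have gb_le : q g b <= 2 * q g g.
    apply: le_trans D_gb; rewrite ler_peMl ?(ltW gb_gt0) //.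
    by move: D_c c_gt0; lra.
  have dist i : P i -> q (v i - vm) (v i - vm) <= 22 ^+ 2 * q g g.
    move=> Pi; rewrite -(ler_pM2l gg_gt0).
    apply: (le_trans (rcs _ _ gg_gt0)).
    have -> : q g g * (22 ^+ 2 * q g g) = (22 * q g g) ^+ 2 by ring.
    have gd : `|q g (v i - vm)| <= 22 * q g g.
      rewrite bilDr bilNr ler_norml.
      by have := gv_ge i Pi; have := stack_gv_lt0 i Pi;
         move: gvm_le gvm_ge gb_le; lra.
    rewrite -[leLHS]real_normK ?num_real // ler_pXn2r ?nnegrE //.
    by rewrite mulr_ge0 // ltW.
  have : \sum_(i | P i) w i * q (v i - vm) (v i - vm) <= W * (22 ^+ 2 * q g g).
    by rewrite mulr_suml; apply: ler_sum => i Pi; rewrite ler_wpM2l // dist.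
  rewrite (sum_bil_shift _ Gsym) -/V -/W [in q vm V]VE bilZr => h.
  rewrite -(ler_pM2l W0).
  have : 4 * t0 <= W * (4 * t0) by rewrite ler_peMl ?mulr_ge0 //; lra.
  by move: h low; lra.
have e0 : 0 < e by rewrite divr_gt0 // mulr_gt0 // addr_gt0 // mulr_gt0.
have eE : e * (1 + 2 * M) = M / 12 by rewrite /e; field; lra.
have e1 : e <= 1.
  rewrite ler_pdivrMr ?mul1r; first by lra.
  by rewrite mulr_gt0 // addr_gt0 // mulr_gt0.
have Mg := mulr_gt0 M0 gg_gt0.
have tg := mulr_ge0 t00 (ltW gg_gt0).
have Mgg : M <= M * q g g by rewrite ler_peMr // ltW.
have tgg : t0 <= t0 * q g g by rewrite ler_peMr.
have W24 : 4 <= W ^+ 2 by have := ler_pM _ _ W_ge2 W_ge2; rewrite expr2; lra.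
have qle : q vm vm <= 2 * M.
  have [neg|pos] := lerP (q vm vm) 0; first by lra.
  by apply: le_trans up; rewrite ler_peMl ?(ltW pos) //; lra.
have uk : 1 + `|q vm vm| <= k5 * q g g.
  suff : `|q vm vm| <= 22 ^+ 2 * q g g + 2 * M * q g g + 4 * t0 * q g g.
    by rewrite /k5; lra.
  by rewrite ler_norml; lra.
have := @stack_concave vm i0 e k0 k1 k5 _ Pi0 W_ge2 e0 k00 erefl uk De Dk VE
  erefl bV.
move=> /le_trans; apply.
have W12 := ltW stack_W_lt.
(* If [<vm,vm> <= 0], then [e <= 1] leaves only the error [W * e]. *)
have [neg|pos] := lerP (q vm vm) 0.
  rewrite ler0_norm //.
  have -> : q vm vm + e * (1 + - q vm vm) = e + (1 - e) * q vm vm by ring.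
  apply: le_trans (_ : W * e <= _).
    rewrite ler_pM2l // gerDl mulr_ge0_le0 //; lra.
  apply: le_trans (_ : 12 * e <= _); first by rewrite ler_pM2r.
  by have := mulr_gt0 e0 M0; lra.
(* The left side is [<V,V> / W], and [W >= 2] saves half of [2 * M] for the error term [h2]. *)
have h1 : W * q vm vm <= M.
  have : 2 * (W * q vm vm) <= W * (W * q vm vm).
    by rewrite ler_wpM2r // mulr_ge0 // ltW.
  by move: up; rewrite expr2; lra.
have h2 : W * (e * (1 + q vm vm)) <= M.
  apply: le_trans (_ : 12 * (e * (1 + 2 * M)) <= _); last by rewrite eE; lra.
  apply: ler_pM => //; first exact: ltW.
    by rewrite mulr_ge0 ?(ltW e0) //; lra.
  by rewrite ler_pM2l //; lra.
by rewrite gtr0_norm // mulrDr; lra.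
Qed.

End StackFamily.

(** * Integral coordinates *)

Section Generic.
Context {R : realType}.

Lemma seq_max_image_ge {I : finType} (A : {pred I}) (f : I -> R) i :
  i \in A -> f i <= seq_max [seq f i | i in A].
Proof.
move=> iA; apply: (le_bigmax_seq _ (f i)) => //.
by apply/fintype.imageP; exists i.
Qed.

Lemma seq_min_image {I : finType} (A : {pred I}) (f : I -> R) i :
  i \in A -> exists2 k, k \in A & seq_min [seq f i | i in A] = f k.
Proof.
move=> iA; apply/fintype.imageP.
have : f i \in [seq f i | i in A] by apply/fintype.imageP; exists i.
rewrite /seq_min; case: (fintype.image f A) => // y t _; rewrite big_seq.
elim/big_ind: _ => [|y1 z yt zt|y1 //]; first exact: mem_head.
by rewrite /Num.min; case: ifP.
Qed.

Lemma pos_lower_bound (I : finType) (P : pred I) (f : I -> R) :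
  (forall i, P i -> 0 < f i) ->
  exists2 e, 0 < e & forall i, P i -> e <= f i.
Proof.
move=> f0; exists (\big[Num.min/1]_(i | P i) f i).
  by elim/big_ind: _ => // y z y0 z0; rewrite lt_min y0.
by move=> i Pi; exact: bigmin_le_cond.
Qed.

Lemma weighted_sum_neg_term (I : finType) (g z : I -> R) i :
  (forall l, 0 < g l) -> \sum_l g l * z l <= 0 -> 0 < z i ->
  exists l, z l < 0.
Proof.
move=> g0 gz zi; apply: contrapT => nex.
have z0 l : 0 <= z l by rewrite leNgt; apply/negP => zl; apply: nex; exists l.
move: gz; rewrite (bigD1 i) //= leNgt ltr_wpDr ?mulr_gt0 //.
by apply: sumr_ge0 => l _; rewrite mulr_ge0 // ltW.
Qed.

End Generic.

Section PsdCoordinates.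
Context {R : realType} {p : nat} (B : base_data p).
Local Notation C := (Cmx R B).
Hypothesis Csym : C^T = C.

Lemma bil_sum (G : 'M[R]_p) u v :
  bil G u v = \sum_i \sum_k u i 0 * v k 0 * G i k.
Proof.
rewrite /bil mxE exchange_big /=; apply: eq_bigr => k _.
rewrite mxE mulr_suml; apply: eq_bigr => i _.
by rewrite !mxE mulrAC.
Qed.

Lemma bil_Mik y i k v :
  bil (Mik B y i k) v v =
  2 * y * (bil C v (delta_mx i 0) * bil C v (delta_mx k 0)) - bil C v v.
Proof.
have e l : bil C v (delta_mx l 0) = \sum_n v n 0 * C l n.
  by rewrite (bilC _ Csym) bil_delta; apply: eq_bigr => n _; rewrite bil_delta_mx.
rewrite (bil_sum (Mik _ _ _ _)) (bil_sum C v v).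
have -> : 2 * y * (bil C v (delta_mx i 0) * bil C v (delta_mx k 0)) =
   y * (bil C v (delta_mx i 0) * bil C v (delta_mx k 0)) +
   y * (bil C v (delta_mx k 0) * bil C v (delta_mx i 0)) by ring.
rewrite !e !big_distrlr /= !mulr_sumr -big_split -sumrB /=; apply: eq_bigr => l _.
rewrite !mulr_sumr -big_split -sumrB /=; apply: eq_bigr => n _.
by rewrite mxE; ring.
Qed.

Context (x : {set 'I_p} -> rat).
Hypothesis admx : admissible_x R B x.

Lemma psd_coord i k v : i != k ->
  bil C v v <=
  2 * ratr (x [set i; k]) * (bil C v (delta_mx i 0) * bil C v (delta_mx k 0)).
Proof.
move=> ik; have [_ [_ /(_ v)]] := admx i k ik.
by rewrite bil_Mik subr_ge0.
Qed.

Lemma ratr_x_gt0 i k : i != k -> 0 < ratr (x [set i; k]) :> R.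
Proof. by move=> ik; have [x0 _] := admx i k ik; rewrite ltr0q. Qed.

Lemma int_coord_bound e i k v :
  (forall a b, a != b -> e <= ratr (x [set a; b])) ->
  (forall l, bil C v (delta_mx l 0) \is a Num.int) ->
  bil C v (delta_mx i 0) * bil C v (delta_mx k 0) < 0 ->
  2 * e * `|bil C v (delta_mx i 0)| <= - bil C v v.
Proof.
move=> ex vint ikneg.
have ik : i != k.
  apply: contraTneq ikneg => ->; rewrite -leNgt -expr2; exact: sqr_ge0.
have := psd_coord i k v ik; have := ex _ _ ik; have := ratr_x_gt0 i k ik.
move: ikneg (vint k).
move: (bil C v (delta_mx i 0)) (bil C v (delta_mx k 0)) => a b ab bint.
have b0 : b != 0 by apply: contraTneq ab => ->; rewrite mulr0 ltxx.
have b1 : 1 <= `|b| by exact: norm_intr_ge1.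
move: (ratr _) (bil C v v) => y q y0 ey h.
rewrite lerNr; apply: (le_trans h).
have -> : 2 * y * (a * b) = - (2 * y * (`|a| * `|b|)).
  by rewrite -normrM ltr0_norm //; ring.
rewrite lerN2 -!mulrA ler_pM2l //.
have a0 := normr_ge0 a.
have ya : 0 <= y * `|a| by rewrite mulr_ge0 // ltW.
apply: (le_trans (ler_wpM2r a0 ey)).
by rewrite mulrA ler_peMr.
Qed.

End PsdCoordinates.

(** * Supersymmetric stacks *)

Section SingleStack.
Context {R : realType} {p : nat} (B : base_data p).
Local Notation C := (Cmx R B).
Local Notation b := (bvec R B).
Local Notation q := (bil C).
Hypothesis Csym : C^T = C.
Context (J F : 'cV[R]_p.+1).
Local Notation j0 := (J 0 0).
Local Notation m := (F 0 0).

(* Component along the base in the basis D_0 - c_1 / 2, D_1, ..., D_p, for    *)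
(* which the triple form has no terms quadratic in the first vector and       *)
(* linear in the others.                                                      *)
Definition kahler_shift : 'cV[R]_p := base_part J + (J 0 0 / 2) *: b.
Definition flux_slope : 'cV[R]_p := (2 / F 0 0) *: (base_part F + F 0 0 *: b).
Local Notation g := kahler_shift.
Local Notation v := flux_slope.

Lemma base_part_D i : base_part (Dclass R (lift ord0 i)) = delta_mx i 0 :> 'cV[R]_p.
Proof. by apply/colP => l; rewrite !mxE (inj_eq lift_inj). Qed.

Lemma base_part_D0 : base_part (Dclass R ord0) = 0 :> 'cV[R]_p.
Proof. by apply/colP => l; rewrite !mxE. Qed.

Lemma Kform_JJJ :
  Kform B J J J = j0 ^+ 3 * q b b / 4 + 3 * j0 * q g g.
Proof.
rewrite KformE // /kahler_shift !bilE (bilC _ Csym (base_part J) b).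
by field.
Qed.

Lemma Kform_JJF0 : m = 0 -> Kform B J J F = 2 * j0 * q g (base_part F).
Proof. by move=> m0; rewrite KformE // m0 /kahler_shift !bilE; field. Qed.

Lemma Kform_FFF0 : m = 0 -> Kform B F F F = 0.
Proof. by move=> m0; rewrite KformE // m0; ring. Qed.

Lemma Kform_FFD i : Kform B F F (Dclass R (lift ord0 i)) =
  m * (2 * q (base_part F) (delta_mx i 0) + m * q b (delta_mx i 0)).
Proof. by rewrite KformE // base_part_D mxE /=; ring. Qed.

Lemma Kform_FFD0 : Kform B F F (Dclass R ord0) =
  q (base_part F + m *: b) (base_part F + m *: b).
Proof.
rewrite KformE // base_part_D0 !bil0r !bilE (bilC _ Csym (base_part F) b).
by rewrite mxE eqxx /=; ring.
Qed.

Hypothesis m_neq0 : m != 0.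

Lemma base_partE : base_part F = (m / 2) *: v - m *: b.
Proof.
rewrite /flux_slope scalerA (_ : m / 2 * (2 / m) = 1) ?scale1r ?addrK //.
by field.
Qed.

Lemma Kform_JJF :
  Kform B J J F = m * (q (base_part J) (base_part J) + j0 * q g v).
Proof.
rewrite KformE // base_partE; move: v => w; rewrite /kahler_shift !bilE.
by rewrite (bilC _ Csym (base_part J) b); field.
Qed.

Lemma Kform_FFF : Kform B F F F = 3 * m * (m ^+ 2 * susy_defect C b v).
Proof.
rewrite KformE // base_partE /susy_defect; move: v => w; rewrite !bilE.
by rewrite (bilC _ Csym w b); field.
Qed.

Lemma Kform_JFF : Kform B J F F =
  j0 * m ^+ 2 * q b b / 4 + j0 * m ^+ 2 * q (v - b) (v - b) / 4
  + m ^+ 2 * q g (v - b).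
Proof.
rewrite KformE // base_partE; move: v => w; rewrite /kahler_shift !bilE.
by rewrite (bilC _ Csym w b) (bilC _ Csym (base_part J) b); field.
Qed.

Lemma Kform_FFDv i : Kform B F F (Dclass R (lift ord0 i)) =
  m ^+ 2 * q (v - b) (delta_mx i 0).
Proof. by rewrite Kform_FFD base_partE; move: v => w; rewrite !bilE; field. Qed.

Lemma Kform_FFD0v : Kform B F F (Dclass R ord0) = m ^+ 2 * q v v / 4.
Proof.
by rewrite Kform_FFD0 base_partE subrK; move: v => w; rewrite !bilE; field.
Qed.

End SingleStack.

Section SupersymmetricConfiguration.
Context {R : realType} {p : nat} (B : base_data p) (S : configuration R p).
Local Notation C := (Cmx R B).
Local Notation b := (bvec R B).
Local Notation q := (bil C).
Local Notation F a := (fluxR S a).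
Local Notation J := (kahler S).
Local Notation g := (kahler_shift B (kahler S)).
Local Notation v a := (flux_slope B (fluxR S a)).
Local Notation N a := ((mult S a)%:R : R).
Hypothesis Csym : C^T = C.
Hypothesis susy : supersymmetric B S.

(** The weight [N m_0^2] as a natural number, so that a total weight above 1 is at least 2. An
    integral [m_0] equals its numerator. *)
Definition stack_weight (a : 'I_(nstacks S)) : nat :=
  (mult S a * `|numq (flux S a ord0 0%R)| ^ 2)%N.
Local Notation w a := ((stack_weight a)%:R : R).

Lemma base_part_fluxR a : base_part (F a) = base_fluxR S a.
Proof. by apply/colP => i; rewrite !mxE. Qed.

Lemma fluxR0E a : F a 0 0 = (numq (flux S a ord0 0))%:~R.
Proof.
have [_ /(_ a)[/intrP[n fn] _] _ _ _] := susy.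
by rewrite mxE fn numq_int ratr_int.
Qed.

Lemma gamma_fluxR a : gamma_brane S a = (F a 0 0 == 0).
Proof. by rewrite fluxR0E intr_eq0 numq_eq0. Qed.

Lemma stack_weightE a : w a = N a * F a 0 0 ^+ 2.
Proof.
by rewrite /stack_weight natrM natrX fluxR0E natr_absz intr_norm
           real_normK ?num_real.
Qed.

Lemma mult_ge1 a : 1 <= N a.
Proof. by have [/(_ a) h _ _ _ _] := susy; rewrite ler1n. Qed.

Lemma nongamma_sq_ge1 a : ~~ gamma_brane S a -> 1 <= F a 0 0 ^+ 2.
Proof.
rewrite gamma_fluxR fluxR0E -real_normK ?num_real // => h.
by apply: exprn_ege1; apply: norm_intr_ge1.
Qed.

Lemma gamma_orthogonal a : gamma_brane S a -> q g (base_fluxR S a) = 0.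
Proof.
rewrite gamma_fluxR => /eqP m0.
have [_ _ J0 _ /(_ a)[e _]] := susy.
move: e; rewrite /= Kform_JJF0 // Kform_FFF0 // base_part_fluxR.
move/eqP; rewrite !mulf_eq0 !pnatr_eq0 /= => /orP[/eqP j0|/eqP //].
by have := J0 ord0; rewrite j0 ltxx.
Qed.

(** The common factor [3 m_0] of both sides of the supersymmetry equation cancels. *)
Lemma nongamma_susyE a : ~~ gamma_brane S a ->
  q (base_part J) (base_part J) + J 0 0 * q g (v a) =
    F a 0 0 ^+ 2 * susy_defect C b (v a).
Proof.
rewrite gamma_fluxR => m0; have [_ _ _ _ /(_ a)[e _]] := susy.
move: e; rewrite /= Kform_JJF // Kform_FFF // mulrA => /mulfI -> //.
by rewrite mulf_neq0 // pnatr_eq0.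
Qed.

Lemma nongamma_susyI a : ~~ gamma_brane S a ->
  3 * (J 0 0 * F a 0 0 ^+ 2 * q b b / 4
       + J 0 0 * F a 0 0 ^+ 2 * q (v a - b) (v a - b) / 4
       + F a 0 0 ^+ 2 * q g (v a - b))
  < J 0 0 ^+ 3 * q b b / 4 + 3 * J 0 0 * q g g.
Proof.
rewrite gamma_fluxR => m0; have [_ _ _ _ /(_ a)[_]] := susy.
by rewrite /= Kform_JFF // Kform_JJJ.
Qed.

(** Gamma-branes drop out because [K(F, F, D_i)] carries a factor [m_0]. *)
Lemma tadpole_base i :
  \sum_(a | ~~ gamma_brane S a) w a * q (v a - b) (delta_mx i 0) =
  (nD5 S (lift ord0 i))%:R - 12 * q b (delta_mx i 0).
Proof.
have [_ _ _ [/(_ (lift ord0 i)) h _] _] := susy.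
move: h; rewrite /tadpoles liftK /tadpole K00E // => ->.
rewrite [RHS](bigID (gamma_brane S)) /= [X in _ = X + _]big1 ?add0r => [|a].
  apply: eq_bigr => a; rewrite gamma_fluxR => m0.
  by rewrite Kform_FFDv // stack_weightE mulrA.
by rewrite gamma_fluxR => /eqP m0; rewrite Kform_FFD // m0 mul0r mulr0.
Qed.

(** This identity converts an upper bound for the stacks with [m_0 <> 0] into one for the
    gamma-branes. *)
Lemma tadpole_fibre :
  \sum_(a | ~~ gamma_brane S a) w a * q (v a) (v a) / 4
  + \sum_(a | gamma_brane S a) N a * q (base_fluxR S a) (base_fluxR S a) =
  (nD5 S ord0)%:R - tadpole0 R B.
Proof.
have [_ _ _ [/(_ ord0) h _] _] := susy.
move: h; rewrite /tadpoles unlift_none => ->.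
rewrite [RHS](bigID (gamma_brane S)) /= [RHS]addrC; congr (_ + _).
  apply: eq_bigr => a; rewrite gamma_fluxR => m0.
  by rewrite Kform_FFD0v // stack_weightE !mulrA.
apply: eq_bigr => a; rewrite gamma_fluxR => /eqP m0.
by rewrite Kform_FFD0 // m0 scale0r addr0 base_part_fluxR.
Qed.

End SupersymmetricConfiguration.

(** * Admissible bases *)

Section AdmissibleBase.
Context {R : realType} {p : nat} (B : base_data p) (x : {set 'I_p} -> rat).
Hypothesis p_ge2 : (2 <= p)%N.
Hypothesis admB : admissible_base R B.
Hypothesis admx : admissible_x R B x.
Local Notation C := (Cmx R B).
Local Notation b := (bvec R B).
Local Notation q := (bil C).
Local Notation D i := (delta_mx i 0 : 'cV[R]_p).
Local Notation T i := (tadpole R B i).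
Local Notation M := (max_x R x * min_T R B * max_T R B).

Lemma Cmx_sym : C^T = C.
Proof. by case: admB => _ _ _ []. Qed.

Lemma Cmx_rcs : reverse_cauchy_schwarz C.
Proof. by case: admB => _ _ _; exact: lorentzian_rcs. Qed.

Lemma bvec_ge0 i : 0 <= b i 0.
Proof. by case: admB. Qed.

Lemma bD_gt0 i : 0 < q b (D i).
Proof. by case: admB => _ _ /(_ i)[_ h] _; rewrite -K00E // Cmx_sym. Qed.

Lemma bD_int i : q b (D i) \is a Num.int.
Proof. by case: admB => _ _ /(_ i)[h _] _; rewrite -K00E // Cmx_sym. Qed.

Lemma tadpoleE i : T i = 12 * q b (D i).
Proof. by rewrite /tadpole K00E // Cmx_sym. Qed.

(** The sum [<b,b> = sum b_i <b,D_i>] has non-negative terms; if it vanished, [b] would be 0,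
    against [<b,D_i> > 0]. *)
Lemma c1_sq_gt0 : 0 < q b b.
Proof.
pose i0 := Ordinal (ltnW p_ge2).
have nn i : true -> 0 <= b i 0 * q b (D i).
  by move=> _; rewrite mulr_ge0 ?bvec_ge0 // ltW ?bD_gt0.
rewrite lt_def bil_delta sumr_ge0 // andbT; apply/eqP => /psumr_eq0P h.
have b0 : b = 0.
  apply/colP => i; have /eqP := h nn i isT.
  by rewrite mulf_eq0 (gt_eqF (bD_gt0 i)) orbF => /eqP ->; rewrite mxE.
by have := bD_gt0 i0; rewrite b0 (bilC _ Cmx_sym) bil0r ltxx.
Qed.

(** The time-like vector [b] pairs positively with every [D_i], so it can orient the cone in
    [bil_same_cone]. *)
Lemma Cmx_ge0 i k : 0 <= C i k.
Proof.
have [[t _ cone] _ _ _] := admB.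
rewrite -bil_delta_mx.
apply: (bil_same_cone _ Cmx_sym Cmx_rcs b) => //.
- exact: c1_sq_gt0.
- exact: bD_gt0.
- exact: bD_gt0.
- by case: (cone i).
- by case: (cone k).
Qed.

(** The factor [1 + sum b_i] makes every [j_k] at least [d b_k]. As [C] has non-negative entries,
    [<j,D_i> >= d <b,D_i>] and so [<j,j> >= d <j,b>]; integrality of [<b,D_i>] gives
    [<j,b> >= 1]. *)
Lemma large_kahler (d : R) (J : 'cV[R]_p.+1) :
  1 <= d -> (forall I, d * (1 + \sum_i b i 0) <= J I 0) ->
  let j := base_part J in
  [/\ d <= J 0 0, d <= q j j, d * q j b <= q j j & 0 <= q j b].
Proof.
move=> d1 dJ j.
have sb0 : 0 <= \sum_i b i 0 by apply: sumr_ge0 => i _; exact: bvec_ge0.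
have d0 : 0 < d by exact: lt_le_trans d1.
have dle y : d * (1 + \sum_i b i 0) <= y -> d <= y.
  by apply: le_trans; rewrite ler_peMr ?(ltW d0) // lerDl.
have j_ge i : d * (1 + \sum_i b i 0) <= j i 0 by rewrite mxE; exact: dJ.
have j_gt0 i : 0 < j i 0 by exact: lt_le_trans (dle _ (j_ge i)).
have jD i : d * q b (D i) <= q j (D i).
  rewrite (bilC _ Cmx_sym b) (bilC _ Cmx_sym j) !(bil_delta _ (D i)) mulr_sumr.
  apply: ler_sum => k _; rewrite bil_delta_mx mulrA ler_wpM2r ?Cmx_ge0 //.
  apply: le_trans (j_ge k); rewrite ler_pM2l //.
  rewrite (bigD1 k) //= addrCA lerDl addr_ge0 // sumr_ge0 // => l _.
  exact: bvec_ge0.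
have jbE : q j b = \sum_i j i 0 * q b (D i) by rewrite (bilC _ Cmx_sym) bil_delta.
have jb1 : 1 <= q j b.
  pose i0 := Ordinal (ltnW p_ge2).
  rewrite jbE (bigD1 i0) //= ler_wpDr ?sumr_ge0 // => [i _|].
    by rewrite mulr_ge0 // ltW // bD_gt0.
  rewrite -[1]mulr1; apply: ler_pM => //.
    by apply: le_trans d1 _; exact: dle.
  have := @norm_intr_ge1 _ _ (bD_int i0).
  by rewrite gt_eqF ?bD_gt0 // gtr0_norm ?bD_gt0 //; exact.
have jjd : d * q j b <= q j j.
  rewrite jbE [leRHS]bil_delta mulr_sumr; apply: ler_sum => i _.
  by rewrite mulrCA ler_pM2l.
split=> //.
- exact: dle.
- by apply: le_trans jjd; rewrite ler_peMr // ltW.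
- exact: le_trans jb1.
Qed.

Lemma max_x_ge i k : i != k -> ratr (x [set i; k]) <= max_x R x.
Proof.
move=> ik; have := seq_max_image_ge [set A : {set 'I_p} | #|A| == 2%N]%SET
  (fun A => ratr (x A) : R) [set i; k]%SET.
by rewrite inE cards2 ik; exact.
Qed.

Lemma max_T_ge i : T i <= max_T R B.
Proof. exact: (seq_max_image_ge _ (tadpole R B)). Qed.

Lemma min_T_attained : exists i, min_T R B = T i.
Proof.
have [i _ e] : exists2 i, i \in 'I_p & min_T R B = T i.
  by apply: (seq_min_image _ (tadpole R B) (Ordinal (ltnW p_ge2))).
by exists i.
Qed.

Lemma other_index (i : 'I_p) : exists k, i != k.
Proof.
have := cardC1 i; rewrite card_ord => h.
have /card_gt0P[k] : (0 < #|predC1 i|)%N by rewrite h -subn1 subn_gt0.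
by rewrite inE eq_sym => ik; exists k.
Qed.

Lemma T_gt0 i : 0 < T i.
Proof. by rewrite tadpoleE mulr_gt0 // bD_gt0. Qed.

Lemma bound_gt0 : 0 < M.
Proof.
have [i ->] := min_T_attained; have [k ik] := other_index i.
apply: mulr_gt0; first apply: mulr_gt0 (T_gt0 i).
  exact: lt_le_trans (ratr_x_gt0 B x admx _ _ ik) (max_x_ge _ _ ik).
exact: lt_le_trans (T_gt0 i) (max_T_ge i).
Qed.

Section TadpoleVector.
Context (V w : 'cV[R]_p).
Hypothesis V_int : forall i, q V (D i) \is a Num.int.
Hypothesis V_ge : forall i, - T i <= q V (D i).
Hypothesis w_gt0 : forall i, 0 < w i 0.
Hypothesis wV : q w V <= 0.

Lemma neg_coord i : 0 < q V (D i) -> exists k, q V (D k) < 0.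
Proof.
apply: (weighted_sum_neg_term _ (fun l => w l 0) (fun l => q V (D l))) => //.
by rewrite -bil_delta (bilC _ Cmx_sym).
Qed.

(** Two distinct coordinates with non-positive product give [<V,V> <= 0] by [psd_coord]. Otherwise
    the coordinate of minimal [T_i] and any other one are both at most 0 and bounded by their [T],
    whence the product [min T * max T]. *)
Lemma tadpole_vector_sq_le : q V V <= 2 * M.
Proof.
have [i minE] := min_T_attained.
have neg k l : q V (D k) * q V (D l) <= 0 -> k != l -> q V V <= 2 * M.
  move=> h kl; apply: le_trans (_ : 0 <= _).
    apply: (le_trans (psd_coord B Cmx_sym x admx _ _ V kl)).
    by rewrite mulr_ge0_le0 // mulr_ge0 // ltW // (ratr_x_gt0 B x admx).
  by rewrite mulr_ge0 // ltW // bound_gt0.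
have [Vi|Vi] := lerP (q V (D i)) 0.
  have [k ik] := other_index i.
  have [Vk|Vk] := lerP (q V (D k)) 0; last first.
    by apply: (neg i k) => //; rewrite mulr_le0_ge0 // ltW.
  apply: (le_trans (psd_coord B Cmx_sym x admx _ _ V ik)).
  rewrite minE -[leLHS]mulrA -[in leRHS](mulrA (max_x R x)) ler_pM2l //.
  have x0 := ratr_x_gt0 B x admx _ _ ik.
  apply: ler_pM; [exact: ltW | exact: mulr_le0 | exact: max_x_ge | ].
  rewrite -mulrNN; apply: ler_pM; rewrite ?oppr_ge0 //.
    by rewrite lerNl.
  by apply: le_trans (max_T_ge k); rewrite lerNl.
have [k Vk] := neg_coord i Vi.
apply: (neg i k); first by rewrite mulr_ge0_le0 // ltW.
by apply: contraTneq Vk => <-; rewrite -leNgt ltW.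
Qed.

(** A non-positive coordinate of [V] is bounded by [T_i]; a positive one has a negative partner, and
    [int_coord_bound] bounds it by [|<V,V>| / (2e)]. *)
Lemma tadpole_vector_c1_le e :
  0 < e -> (forall i k, i != k -> e <= ratr (x [set i; k])) ->
  `|q b V| <= (\sum_i b i 0 * (T i + (2 * e)^-1)) * (1 + `|q V V|).
Proof.
move=> e0 ex; rewrite (bilC _ Cmx_sym) bil_delta mulr_suml.
apply: (le_trans (ler_norm_sum _ _ _)); apply: ler_sum => i _.
rewrite normrM ger0_norm ?bvec_ge0 // -mulrA ler_wpM2l ?bvec_ge0 //.
have e2 : 0 <= (2 * e)^-1 by rewrite invr_ge0 mulr_ge0 // ltW.
have T0 := ltW (T_gt0 i).
have n0 := normr_ge0 (q V V).
have [Vi|Vi] := lerP (q V (D i)) 0.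
  rewrite ler0_norm //; apply: le_trans (_ : T i <= _); first by rewrite lerNl.
  move: T0 e2 (mulr_ge0 T0 n0) (mulr_ge0 e2 n0).
  by move: (T i) (_^-1) `|q V V| => t y n; lra.
have [k Vk] := neg_coord i Vi.
have h : 2 * e * `|q V (D i)| <= - q V V.
  apply: (int_coord_bound B Cmx_sym x admx e i k V ex V_int).
  by rewrite pmulr_rlt0.
rewrite (gtr0_norm Vi) in h *.
have {}h : q V (D i) <= (2 * e)^-1 * `|q V V|.
  rewrite mulrC ler_pdivlMr ?mulr_gt0 // mulrC; apply: (le_trans h).
  by rewrite -normrN ler_norm.
apply: (le_trans h); move: T0 e2 (mulr_ge0 T0 n0) (mulr_ge0 e2 n0).
by move: (T i) (_^-1) `|q V V| => t y n; lra.
Qed.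

End TadpoleVector.

End AdmissibleBase.

(** * Bounds for one configuration with large [J] *)

Section LargeKahlerClass.
Context {R : realType} {p : nat} (B : base_data p) (x : {set 'I_p} -> rat).
Hypothesis p_ge2 : (2 <= p)%N.
Hypothesis admB : admissible_base R B.
Hypothesis admx : admissible_x R B x.
Context (S : configuration R p) (d : R).
Hypothesis susy : supersymmetric B S.
Hypothesis d_ge1 : 1 <= d.
Hypothesis dJ : forall I, d * (1 + \sum_i bvec R B i 0) <= kahler S I 0.
Local Notation C := (Cmx R B).
Local Notation b := (bvec R B).
Local Notation q := (bil C).
Local Notation D i := (delta_mx i 0 : 'cV[R]_p).
Local Notation T i := (tadpole R B i).
Local Notation M := (max_x R x * min_T R B * max_T R B).
Local Notation j := (base_part (kahler S)).
Local Notation j0 := (kahler S 0 0).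
Local Notation g := (kahler_shift B (kahler S)).
Local Notation v := (fun a => flux_slope B (fluxR S a)).
Local Notation w := (stack_weight S).
Local Notation P := (fun a => ~~ gamma_brane S a).
Local Notation V := (\sum_(a | P a) (w a)%:R *: v a).

Let Csym := Cmx_sym B admB.
Let rcs := Cmx_rcs B admB.

Lemma kahler_shift_gt0 i : 0 < g i 0.
Proof.
have [_ _ J0 _ _] := susy.
have -> : g i 0 = kahler S (lift ord0 i) 0 + j0 / 2 * b i 0 by rewrite !mxE.
rewrite ltr_wpDr ?J0 // mulr_ge0 ?(bvec_ge0 B) //.
by rewrite divr_ge0 // ltW // J0.
Qed.

Lemma kahler_shift_sq_gt0 : 0 < q g g.
Proof.
have [dj0 djj _ jb] := large_kahler B p_ge2 admB d (kahler S) d_ge1 dJ.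
have j0_gt0 : 0 < j0 by exact: lt_le_trans ltr01 (le_trans d_ge1 dj0).
have -> : q g g = q j j + j0 * q j b + j0 ^+ 2 * q b b / 4.
  by rewrite /kahler_shift !bilE (bilC _ Csym b j); field.
have h1 := mulr_ge0 (ltW j0_gt0) jb.
have h2 := mulr_gt0 (exprn_gt0 2 j0_gt0) (c1_sq_gt0 B p_ge2 admB).
by move: djj d_ge1; lra.
Qed.

Lemma gamma_sq_le0 a : gamma_brane S a ->
  q (base_fluxR S a) (base_fluxR S a) <= 0.
Proof.
move=> ga; have := rcs _ (base_fluxR S a) kahler_shift_sq_gt0.
by rewrite gamma_orthogonal // expr0n /= pmulr_rle0 // kahler_shift_sq_gt0.
Qed.

(** Passing from [v - b] to [v] adds the non-negative integer [W <b,D_i>], so both [V_i >= - T_i]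
    and integrality can be read off. *)
Let wV_coord i : q V (D i) =
  (nD5 S (lift ord0 i))%:R - T i + (\sum_(a | P a) (w a)%:R) * q b (D i).
Proof.
rewrite (bilC _ Csym) bil_sumr tadpoleE // -tadpole_base // mulr_suml -big_split.
by apply: eq_bigr => a _ /=; rewrite (bilC _ Csym (D i)) !bilE; ring.
Qed.

(** The tadpole conditions for the [D_i], paired with the positive coordinates of [g]. *)
Let tadpole_shift :
  - (12 * q g b) <= \sum_(a | P a) (w a)%:R * q g (v a - b).
Proof.
have gE u : q g u = \sum_i g i 0 * q u (D i) by rewrite (bilC _ Csym) bil_delta.
have -> : \sum_(a | P a) (w a)%:R * q g (v a - b) =
    \sum_i g i 0 * ((nD5 S (lift ord0 i))%:R - 12 * q b (D i)).
  under [RHS]eq_bigr => i _ do rewrite -tadpole_base // mulr_sumr.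
  rewrite exchange_big /=; apply: eq_bigr => a _.
  by rewrite gE mulr_sumr; apply: eq_bigr => i _; rewrite mulrCA.
rewrite gE mulr_sumr -sumrN; apply: ler_sum => i _.
rewrite mulrCA -mulrN ler_pM2l ?kahler_shift_gt0 //.
by rewrite lerDr.
Qed.

Lemma nongamma_sum_le e :
  0 < e -> (forall i k, i != k -> e <= ratr (x [set i; k])) ->
  let k0 := \sum_i b i 0 * (T i + (2 * e)^-1) in
  let k1 := q b b + 6 * k0 + 1 in
  let k5 := 22 ^+ 2 + 1 + 2 * M + 4 * `|tadpole0 R B| in
  200 * (1 + q b b) <= d ->
  (36 * k1) ^+ 2 * k5 <= M / (12 * (1 + 2 * M)) * d ->
  12 ^+ 2 * (k1 * k5 + 36 ^+ 2) <= d ->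
  \sum_(a | P a) (w a)%:R * q (v a) (v a) <= 2 * M.
Proof.
move=> e0 ex k0 k1 k5 dc de dk.
have [dj0 djj djb jb] := large_kahler B p_ge2 admB d (kahler S) d_ge1 dJ.
have c0 := c1_sq_gt0 B p_ge2 admB.
have s1 a : P a -> 1 <= fluxR S a 0 0 ^+ 2 by exact: nongamma_sq_ge1 susy a.
have sw a : P a -> fluxR S a 0 0 ^+ 2 <= (w a)%:R.
  move=> Pa; rewrite (stack_weightE B) // ler_peMl ?sqr_ge0 //.
  exact: mult_ge1 susy a.
have hE a := nongamma_susyE B S Csym susy a.
have hI a := nongamma_susyI B S Csym susy a.
have gV : q g V <= 0.
  exact: (stack_gV_le0 _ Csym rcs P w (fun a => fluxR S a 0 0 ^+ 2) v b j j0 d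
           c0 jb dc dj0 djj djb s1 sw hE hI tadpole_shift).
have V_int i : q V (D i) \is a Num.int.
  have bi := bD_int B admB i.
  rewrite wV_coord rpredD ?rpredB ?rpred_nat //.
    by rewrite tadpoleE // rpredM ?rpred_nat.
  by rewrite rpredM // rpred_sum // => a _; rewrite rpred_nat.
have V_ge i : - T i <= q V (D i).
  rewrite wV_coord addrAC lerDr addr_ge0 // mulr_ge0 ?sumr_ge0 //.
  exact/ltW/(bD_gt0 B admB).
apply: (stack_bound _ Csym rcs P w (fun a => fluxR S a 0 0 ^+ 2) v b j j0 d
  c0 jb dc dj0 djj djb s1 sw hE hI tadpole_shift M k0 `|tadpole0 R B|) => //.
- exact: (bound_gt0 B x).
- apply: sumr_ge0 => i _; rewrite mulr_ge0 ?(bvec_ge0 B) // addr_ge0 //.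
    exact/ltW/(T_gt0 B).
  by rewrite invr_ge0 mulr_ge0 // ltW.
- by move=> a Pa; rewrite -(ltr0n R); apply: lt_le_trans (sw a Pa);
    exact: lt_le_trans ltr01 (s1 a Pa).
- exact: (tadpole_vector_sq_le B x p_ge2 admB admx V g V_ge kahler_shift_gt0 gV).
- exact: (tadpole_vector_c1_le B x admB admx V g V_int V_ge kahler_shift_gt0 gV).
(* What remains is the lower bound [low]: in the tadpole condition for [D_0] the gamma-branes
   contribute non-positively and the D5-branes non-negatively. *)
have := tadpole_fibre B S Csym susy.
rewrite -mulr_suml => h.
have g0 : \sum_(a | gamma_brane S a) (mult S a)%:R *
    q (base_fluxR S a) (base_fluxR S a) <= 0.
  by apply: sumr_le0 => a ga; rewrite mulr_ge0_le0 // gamma_sq_le0.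
have n0 : 0 <= (nD5 S ord0)%:R :> R by [].
have := ler_norm (tadpole0 R B).
move: h g0 n0; move: (_ ord0)%:R (tadpole0 R B) => n t; lra.
Qed.

End LargeKahlerClass.

(** * Finiteness of bounded fluxes and choice of the threshold *)

(** A vector is recovered from its pairings by [invmx G]; integers in [[-n, n]] are encoded in
    ['I_n.*2.+1] with a shift by [n]. *)
Lemma finite_bounded_dual (p : nat) (G : 'M[rat]_p) (n : nat) :
  G \in unitmx ->
  finite_set [set m : 'cV[rat]_p |
    forall i, exists2 z : int, (G *m m) i 0 = z%:~R & (`|z| <= n)%N]%classic.
Proof.
move=> Gu.
pose h (f : {ffun 'I_p -> 'I_n.*2.+1}) : 'cV[rat]_p :=
  invmx G *m \col_i ((f i)%:Z - n%:Z)%:~R.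
apply: (@sub_finite_set _ _ (h @` setT)%classic); last first.
  exact: finite_image finite_finset.
move=> m hm /=.
have hz i : exists k : 'I_n.*2.+1, (G *m m) i 0 = (k%:Z - n%:Z)%:~R.
  have [z -> zn] := hm i.
  have zb : (`|(z + n%:Z)%R| < n.*2.+1)%N by lia.
  by exists (Ordinal zb); congr (_%:~R) => /=; lia.
have [f fE] := choice hz.
exists (finfun f) => //; rewrite /h.
apply: (canLR (mulKmx Gu)); apply/colP => i.
by rewrite fE mxE ffunE.
Qed.

Lemma gram_ratr (R : realType) (p : nat) (B : base_data p) :
  map_mx ratr (map_mx intr (gram B)) = Cmx R B.
Proof. by apply/matrixP => i k; rewrite !mxE ratr_int. Qed.

Lemma base_fluxR_coord (R : realType) (p : nat) (B : base_data p)
    (S : configuration R p) (a : 'I_(nstacks S)) i :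
  (Cmx R B)^T = Cmx R B ->
  bil (Cmx R B) (base_fluxR S a) (delta_mx i 0) =
  ratr ((map_mx intr (gram B) *m base_flux (flux S a)) i 0).
Proof.
move=> Csym; rewrite (bilC _ Csym) bil_delta mxE rmorph_sum.
apply: eq_bigr => k _; rewrite bil_delta_mx -gram_ratr mulrC rmorphM /=.
by rewrite !mxE.
Qed.

Lemma threshold_exists {R : realType} (M k0 c t : R) :
  0 < M -> 0 <= k0 -> 0 < c -> 0 <= t ->
  let k1 := c + 6 * k0 + 1 in
  let k5 := 22 ^+ 2 + 1 + 2 * M + 4 * t in
  exists2 d : R, 1 <= d &
    [/\ 200 * (1 + c) <= d,
        (36 * k1) ^+ 2 * k5 <= M / (12 * (1 + 2 * M)) * d
      & 12 ^+ 2 * (k1 * k5 + 36 ^+ 2) <= d].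
Proof.
move=> M0 k00 c0 t0 k1 k5.
have k10 : 0 <= k1 by rewrite /k1; lra.
have k50 : 0 <= k5 by rewrite /k5; lra.
have eps0 : 0 < M / (12 * (1 + 2 * M)).
  by rewrite divr_gt0 // mulr_gt0 // addr_gt0 // mulr_gt0.
move: k1 k5 (M / _) k10 k50 eps0 => k1 k5 eps k10 k50 eps0.
pose d1 := 200 * (1 + c).
pose d2 := (36 * k1) ^+ 2 * k5 / eps.
pose d3 := 12 ^+ 2 * (k1 * k5 + 36 ^+ 2).
have d1_ge1 : 1 <= d1 by rewrite /d1; lra.
have d2_ge0 : 0 <= d2.
  by rewrite divr_ge0 ?(ltW eps0) // mulr_ge0 // sqr_ge0.
have d3_ge0 : 0 <= d3 by rewrite mulr_ge0 ?sqr_ge0 // addr_ge0 ?sqr_ge0 // mulr_ge0.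
have d1_ge0 := le_trans ler01 d1_ge1.
exists (d1 + d2 + d3); first by rewrite -addrA ler_wpDr // addr_ge0.
split; first by rewrite -addrA lerDl addr_ge0.
  by rewrite -ler_pdivrMl // mulrC -/d2 addrAC lerDr addr_ge0.
by rewrite lerDr addr_ge0.
Qed.

Theorem mainTheorem6 (R : realType) (p : nat) (B : base_data p)
    (x : {set 'I_p} -> rat)
    (p_ge2 : (2 <= p)%N)
    (admB : admissible_base R B)
    (admx : admissible_x R B x) :
  exists jstar : R,
    (forall S : configuration R p,
       supersymmetric B S -> (forall I, jstar <= kahler S I 0) ->
       let Q := - \sum_(a | gamma_brane S a)
                    (mult S a)%:R *
                    bil (Cmx R B) (base_fluxR S a) (base_fluxR S a) in
       0 <= Q /\
       Q <= tadpole0 R B + 2^-1 * max_x R x * min_T R B * max_T R B)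
    /\
    finite_set
      [set m : 'cV[rat]_p |
        exists S : configuration R p,
          [/\ supersymmetric B S,
              (forall I, jstar <= kahler S I 0)
            & exists2 a : 'I_(nstacks S),
                gamma_brane S a & m = base_flux (flux S a)] ]%classic.
Proof.
have Csym := Cmx_sym B admB.
have [e e0 exP] : exists2 e : R, 0 < e &
    forall ik : 'I_p * 'I_p, ik.1 != ik.2 -> e <= ratr (x [set ik.1; ik.2]%SET).
  by apply: pos_lower_bound => -[i k] /= ik; exact: (ratr_x_gt0 B x admx).
have ex i k : i != k -> e <= ratr (x [set i; k]%SET) by exact: (exP (i, k)).
pose M := max_x R x * min_T R B * max_T R B.
have M0 : 0 < M by exact: (bound_gt0 B x).
have c0 := c1_sq_gt0 B p_ge2 admB.
pose k0 := \sum_i bvec R B i 0 * (tadpole R B i + (2 * e)^-1).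
have k00 : 0 <= k0.
  apply: sumr_ge0 => i _; rewrite mulr_ge0 ?(bvec_ge0 B) // addr_ge0 //.
    exact/ltW/(T_gt0 B).
  by rewrite invr_ge0 mulr_ge0 // ltW.
have [d d_ge1 [d_d1 d_d2 d_d3]] :=
  threshold_exists M k0 (bil (Cmx R B) (bvec R B) (bvec R B)) _ M0 k00 c0
    (normr_ge0 (tadpole0 R B)).
(* Built from [B] and [x] alone, hence uniform in the configuration; the second factor is the one
   required by [large_kahler]. *)
exists (d * (1 + \sum_i bvec R B i 0)).
have bound (S : configuration R p) : supersymmetric B S ->
    (forall I, d * (1 + \sum_i bvec R B i 0) <= kahler S I 0) ->
    - \sum_(a | gamma_brane S a) (mult S a)%:R *
        bil (Cmx R B) (base_fluxR S a) (base_fluxR S a)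
    <= tadpole0 R B + M / 2.
  move=> susy dJ.
  have h := nongamma_sum_le B x p_ge2 admB admx S d susy d_ge1 dJ e e0 ex
    d_d1 d_d2 d_d3.
  (* The sum bounded by [2 * M] enters with a factor 1/4, which produces [M / 2]. *)
  have := tadpole_fibre B S Csym susy; rewrite -mulr_suml => h2.
  have n0 : 0 <= (nD5 S ord0)%:R :> R by [].
  move: h h2 n0; rewrite -/M; move: ((_ ord0)%:R : R) => n.
  by clear; lra.
have gneg (S : configuration R p) a : supersymmetric B S ->
    (forall I, d * (1 + \sum_i bvec R B i 0) <= kahler S I 0) ->
    gamma_brane S a ->
    bil (Cmx R B) (base_fluxR S a) (base_fluxR S a) <= 0.
  move=> susy dJ; exact: (gamma_sq_le0 B p_ge2 admB S d susy d_ge1 dJ).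
split.
  move=> S susy dJ Q; split.
    rewrite oppr_ge0; apply: sumr_le0 => a ga.
    by rewrite mulr_ge0_le0 // gneg.
  by apply: (le_trans (bound S susy dJ)); rewrite lerD2l /M mulrC !mulrA.
(* The bound that [int_coord_bound] gives for each [|<m,D_i>|], once [- <m,m>] is at most
   [T_0 + M / 2]. *)
pose bd := (tadpole0 R B + M / 2) / (2 * e).
have Gu : map_mx intr (gram B) \in @unitmx rat p.
  rewrite -(map_unitmx (ratr : {rmorphism rat -> R})) gram_ratr.
  by apply: lorentzian_unitmx; case: admB.
apply: sub_finite_set
  (finite_bounded_dual p (map_mx intr (gram B)) (Num.bound bd) Gu).
move=> m [S [susy dJ [a ga ->]]] i.
have [_ /(_ a)[_ fint] _ _ _] := susy.
have /choice[z zE] l : exists n : int,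
    (map_mx intr (gram B) *m base_flux (flux S a)) l 0 = n%:~R :> rat.
  have /intrP[n nE] := fint l; exists n; rewrite -nE mxE.
  by apply: eq_bigr => k _; rewrite mxE.
exists (z i) => //.
set f := base_fluxR S a.
have fD l : bil (Cmx R B) f (delta_mx l 0) = (z l)%:~R.
  by rewrite base_fluxR_coord // zE ratr_int.
have f_int l : bil (Cmx R B) f (delta_mx l 0) \is a Num.int by rewrite fD intr_int.
have gf : \sum_l kahler_shift B (kahler S) l 0 * (z l)%:~R = 0.
  rewrite -[RHS](gamma_orthogonal B S Csym susy a ga) (bilC _ Csym) bil_delta.
  by apply: eq_bigr => l _; rewrite fD.
have g0 := kahler_shift_gt0 B admB S susy.
have zle : (`|z i|%N%:R : R) <= bd.
  have ff : - bil (Cmx R B) f f <= tadpole0 R B + M / 2.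
    apply: le_trans (bound S susy dJ); rewrite lerN2 (bigD1 a) //=.
    rewrite -[leRHS]addr0; apply: lerD.
      by rewrite ler_neMl ?gneg // (mult_ge1 B).
    apply: sumr_le0 => c /andP[gc _]; by rewrite mulr_ge0_le0 // gneg.
  rewrite natr_absz intr_norm ler_pdivlMr ?mulr_gt0 // mulrC -fD.
  apply: le_trans ff.
  (* In [gf] the weights [g_l] are positive, so a non-zero [z i] has a partner of opposite sign. *)
  have [zi|zi|zi] := ltrgt0P (z i).
  - have [k zk] : exists k, ((z k)%:~R : R) < 0.
      apply: (weighted_sum_neg_term _ _ (fun l => (z l)%:~R) i g0).
        by rewrite gf.
      by rewrite ltr0z.
    apply: (int_coord_bound B Csym x admx e i k f ex f_int).
    by rewrite !fD pmulr_rlt0 // ltr0z.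
  - have [k zk] : exists k, - ((z k)%:~R : R) < 0.
      apply: (weighted_sum_neg_term _ _ (fun l => - (z l)%:~R) i g0).
        by under eq_bigr do rewrite mulrN; rewrite sumrN gf oppr0.
      by rewrite oppr_gt0 ltrz0.
    apply: (int_coord_bound B Csym x admx e i k f ex f_int).
    by rewrite !fD nmulr_rlt0 ?ltrz0 // -oppr_lt0.
  by rewrite fD zi normr0 mulr0 oppr_ge0 gneg.
rewrite -(ler_nat R); apply: (le_trans zle); apply: ltW; apply: archi_boundP.
by apply: le_trans zle.
Qed.
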